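(* Let $k\ge1$, $\mathbf d\in(\mathbb Z_{\ge0})^k$, $d=\sum_i\mathbf d_i$. For every lower crossingless match $b$, the map $T_{Y_b}:\mathcal T(\mathbf d)\to\mathcal M(d)$ is an intertwiner (i.e. commutes with the action of $\mathbf U_q$), and if $b$ has $\mu$ unmatched vertices and $r=(d-\mu)/2$, then $T_{Y_b}(\mathcal T(\mathbf d))\subset\mathcal M^r(d)\cong V_\mu$.
   Context: **Counting convention.** $\mathbb F$ is a finite field whose cardinality is written $q^2$; vector spaces are finite-dimensional over $\mathbb F$. Functions take values in $\mathbb C(q)$, $q$ an indeterminate, and spans are $\mathbb C(q)$-spans. $\mathbf 1_Y$ is the indicator function of $Y$. Numbers of points are viewed in $\mathbb C(q)$: the sets counted are given by the same linear-algebra conditions over every finite field and have $P_Y(|\mathbb F|)$ points for a polynomial $P_Y$, and $\chi_q(Y):=P_Y(q^2)$. Sums of function values over points are understood accordingly; for a map $p$, $p_!(f)(x)=\sum_{y\in p^{-1}(x)}f(y)$, so $p_!(\mathbf 1_Y)(x)=\chi_q(p^{-1}(x)\cap Y)$. **Quantum group.** $\mathbf U_q=U_q(\mathfrak{sl}_2)$ is the $\mathbb C(q)$-algebra generated by $E,F,K^{\pm1}$ with $KK^{-1}=K^{-1}K=1$, $KE=q^2EK$, $KF=q^{-2}FK$, $EF-FE=(K-K^{-1})/(q-q^{-1})$. $V_\mu$ is its irreducible module of dimension $\mu+1$ with highest weight $q^\mu$. **Varieties.** Let $D$ be a $d$-dimensional space. $\mathfrak M(d)=\{(W,t):W\subset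 D,\ t\in\mathrm{End}\,D,\ \operatorname{im}t\subset W\subset\ker t\}$; $\mathfrak M^r(w,d)$ is the subset with $\dim W=w$, $\operatorname{rank}t=r$; $\mathcal M^r(d)=\bigoplus_w\mathbb C(q)\mathbf 1_{\mathfrak M^r(w,d)}$, $\mathcal M(d)=\bigoplus_r\mathcal M^r(d)$. $\mathfrak T(\mathbf d)$ is the set of triples $(\mathbf D,W,t)$ with $(W,t)\in\mathfrak M(d)$ and $\mathbf D=(0=\mathbf D_0\subset\cdots\subset\mathbf D_k=D)$ a flag with $\dim\mathbf D_i/\mathbf D_{i-1}=\mathbf d_i$ and $t(\mathbf D_i)\subset\mathbf D_{i-1}$. For a subspace $X\subset D$, $\alpha(X,\mathbf D)_i=\dim(X\cap\mathbf D_i)/(X\cap\mathbf D_{i-1})$. $\mathcal T(\mathbf d)$ is the span of the indicator functions of the sets $A_{\mathbf w,\mathbf r,\mathbf n}=\{(\mathbf D,W,t):\alpha(W,\mathbf D)=\mathbf w,\ \alpha(\operatorname{im}t,\mathbf D)=\mathbf r,\ \alpha(\ker t,\mathbf D)=\mathbf n\}$. On functions on $\mathfrak T(\mathbf d)$, $\mathbf U_q$ acts by $(Ef)(\mathbf D,W,t)=q^{-(\dim\ker t-\dim W-1)}\sum_{W\subset U\subset\ker t,\ \dim U=\dim W+1}f(\mathbf D,U,t)$, $(Ff)(\mathbf D,W,t)=q^{-(\dim W-\operatorname{rank}t-1)}\sum_{\operatorname{im}t\subset U\subset W,\ \dim U=\dim W-1}f(\mathbf D,U,t)$, $(K^{\pm1}f)(\mathbf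 D,W,t)=q^{\pm(d-2\dim W)}f(\mathbf D,W,t)$, and on functions on $\mathfrak M(d)$ by the same formulas with $\mathbf D$ omitted. **Lower crossingless matches.** Place $k$ boxes from left to right, box $i$ having $\mathbf d_i$ vertices. A lower crossingless match is a set of pairwise non-crossing arcs drawn above the line, each joining two vertices of different boxes, each vertex on at most one arc, and no unmatched vertex lying under an arc. (Those with $\mu$ unmatched vertices correspond to crossingless matches from boxes $\mathbf d_1,\dots,\mathbf d_k$ to a single box $\mu$.) For a match $b$, $\mathbf n^b_i$ is $\mathbf d_i$ minus the number of right endpoints of arcs of $b$ in box $i$. Set $Y_b=\{(\mathbf D,W,t)\in\mathfrak T(\mathbf d):\alpha(\ker t,\mathbf D)=\mathbf n^b\}$. **The maps $T_Y$.** With $p:\mathfrak T(\mathbf d)\to\mathfrak M(d)$, $p(\mathbf D,W,t)=(W,t)$, set $T_Y(f)=p_!(\mathbf 1_Yf)$ for $f\in\mathcal T(\mathbf d)$. *)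

(* Defs.v *)
From HB Require Import structures.
From mathcomp Require Import all_boot all_order all_algebra.
From mathcomp Require Import boolp classical_sets reals.
From mathcomp Require Import complex.
From mathcomp Require Import ring zify.
Set Implicit Arguments.
Unset Strict Implicit.
Unset Printing Implicit Defensive.
Import Order.TTheory GRing.Theory Num.Theory.
Local Open Scope ring_scope.

Section FiniteInstances.
Variables (F : finFieldType) (V W : vectType F).
Import VectorInternalTheory.

HB.instance Definition _ := Countable.copy {vspace V} (can_type (@vs2mxK F V)).
HB.instance Definition _ :=
  isFinite.Build {vspace V} (pcan_enumP (can_pcan (@vs2mxK F V))).

Fact f2mxK : cancel (@f2mx F V W) (@Hom F V W).
Proof. by case. Qed.

HB.instance Definition _ := Countable.copy 'Hom(V, W) (can_type f2mxK).
HB.instance Definition _ :=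
  isFinite.Build 'Hom(V, W) (pcan_enumP (can_pcan f2mxK)).

End FiniteInstances.

(** * Representations of U_q(sl_2)

    An action is given by operators for the four generators, [gKinv] standing
    for [K^-1]. *)

Inductive generator := gE | gF | gK | gKinv.

Section Representations.
Variables (K : fieldType) (q : K).
Implicit Types V W : vectType K.

Definition action V := generator -> V -> V.

Definition is_Uq_module V (a : action V) : Prop :=
  [/\ forall g, linear (a g),
      forall v, a gK (a gKinv v) = v /\ a gKinv (a gK v) = v,
      forall v, a gK (a gE v) = q ^+ 2 *: a gE (a gK v),
      forall v, a gK (a gF v) = q ^- 2 *: a gF (a gK v)
    & forall v, a gE (a gF v) - a gF (a gE v) =
                (q - q^-1)^-1 *: (a gK v - a gKinv v)].

Definition Uq_stable V (a : action V) (U : {vspace V}) : Prop :=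
  forall g v, v \in U -> a g v \in U.

Definition Uq_irreducible V (a : action V) : Prop :=
  (0 < \dim {:V})%N /\
  forall U : {vspace V}, Uq_stable a U -> U = 0%VS \/ U = fullv.

(** [T] is an intertwiner from [(U, a)] to [(U', a')]; the operators [a g] and
    [T] need only be meaningful on [U]. *)
Definition intertwiner V W (a : action V) (U : {vspace V})
    (a' : action W) (U' : {vspace W}) (T : V -> W) : Prop :=
  [/\ Uq_stable a U, Uq_stable a' U', linear T,
      forall v, v \in U -> T v \in U'
    & forall g v, v \in U -> T (a g v) = a' g (T v)].

(** [(V, a)] is isomorphic to [(U, a')]. *)
Definition Uq_isomorphic V W (a : action V) (a' : action W) (U : {vspace W}) : Prop :=
  exists T : V -> W,
    [/\ intertwiner a fullv a' U T, injective T
      & forall w, w \in U -> exists v, T v = w].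

(** The irreducible module of dimension [mu + 1] and highest weight [q ^+ mu],
    in a basis [v_0, ..., v_mu] with [E v_i = [mu - i + 1] v_(i - 1)],
    [F v_i = [i + 1] v_(i + 1)], [K v_i = q ^ (mu - 2 i) v_i], where [n] between
    brackets is [qint n]; matrices act on row vectors from the right.
    [Vmu_spec] checks the description. *)

Definition qint (n : nat) : K := (q ^+ n - q ^- n) / (q - q^-1).

Definition Vmu_mx (mu : nat) (g : generator) : 'M[K]_mu.+1 :=
  match g with
  | gE => \matrix_(i, j) (qint (mu - j) *+ (i == j.+1 :> nat))
  | gF => \matrix_(i, j) (qint j *+ (j == i.+1 :> nat))
  | gK => diag_mx (\row_i q ^ (mu%:Z - (2 * i)%N%:Z))
  | gKinv => diag_mx (\row_i q ^ (- (mu%:Z - (2 * i)%N%:Z)))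
  end.

Definition Vmu (mu : nat) : vectType K := 'rV[K]_mu.+1.

Definition Vmu_act (mu : nat) : action (Vmu mu) := fun g v => v *m Vmu_mx mu g.

Section Vmu_theory.
Hypothesis qX_neq1 : forall n, (0 < n)%N -> q ^+ n != 1.
Hypothesis q_neq0 : q != 0.

Lemma qBqV_neq0 : q - q^-1 != 0.
Proof.
apply/eqP => /subr0_eq qqV; have := qX_neq1 (isT : (0 < 2)%N).
by rewrite expr2 {2}qqV divff ?eqxx.
Qed.

Lemma qint0 : qint 0 = 0.
Proof. by rewrite /qint expr0 invr1 subrr mul0r. Qed.

Lemma qint_neq0 n : (0 < n)%N -> qint n != 0.
Proof.
move=> n_gt0; rewrite /qint mulf_neq0 ?invr_neq0 ?qBqV_neq0 //.
apply/eqP => /subr0_eq qqV; have : q ^+ (n + n) != 1 :> K.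
  by apply: qX_neq1; rewrite addn_gt0 n_gt0.
by rewrite exprD {2}qqV divff ?eqxx ?expf_neq0.
Qed.

Lemma Vmu_E mu (v : Vmu mu) j :
  Vmu_act gE v 0 j = qint (mu - j) * v 0 (inord j.+1).
Proof.
rewrite mxE; have [ltj|] := boolP (j.+1 < mu.+1)%N.
  rewrite (bigD1 (inord j.+1)) //= big1 => [|i ne_i].
    by rewrite mxE inordK // eqxx addr0 mulrC.
  rewrite mxE; case: eqP => [eq_i|_]; last by rewrite mulr0.
  by case/eqP: ne_i; apply: val_inj; rewrite /= inordK.
rewrite -leqNgt => lej; have -> : (mu - j = 0)%N by lia.
by rewrite qint0 mul0r big1 // => i _; rewrite mxE (_ : (mu - j = 0)%N)
  ?qint0 ?mul0rn ?mulr0 //; lia.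
Qed.

Lemma Vmu_F mu (v : Vmu mu) j :
  Vmu_act gF v 0 j = qint j * v 0 (inord j.-1).
Proof.
rewrite mxE; have [j0|j_gt0] := posnP j.
  by rewrite j0 qint0 mul0r big1 // => i _; rewrite mxE j0 mulr0.
have ltj : (j.-1 < mu.+1)%N by have := ltn_ord j; lia.
rewrite (bigD1 (inord j.-1)) //= big1 => [|i ne_i].
  by rewrite mxE inordK // prednK // eqxx addr0 mulrC.
rewrite mxE; case: eqP => [eq_j|_]; last by rewrite mulr0.
by case/eqP: ne_i; apply: val_inj; rewrite /= inordK // eq_j.
Qed.

Lemma Vmu_K mu (v : Vmu mu) j :
  Vmu_act gK v 0 j = q ^ (mu%:Z - (2 * j)%N%:Z) * v 0 j.
Proof. by rewrite /Vmu_act mul_mx_diag !mxE mulrC. Qed.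

Lemma Vmu_Kinv mu (v : Vmu mu) j :
  Vmu_act gKinv v 0 j = (q ^ (mu%:Z - (2 * j)%N%:Z))^-1 * v 0 j.
Proof. by rewrite /Vmu_act mul_mx_diag !mxE invr_expz mulrC. Qed.

Lemma Vmu_ext mu (u v : Vmu mu) : (forall j, u 0 j = v 0 j) -> u = v.
Proof. by move=> uv; apply/rowP. Qed.

Lemma Vmu_Z mu (a : K) (u : Vmu mu) j : (a *: u) 0 j = a * u 0 j.
Proof. by rewrite mxE. Qed.

Lemma Vmu_B mu (u v : Vmu mu) j : (u - v) 0 j = u 0 j - v 0 j.
Proof. by rewrite !mxE. Qed.

Lemma Vmu_module mu : is_Uq_module (@Vmu_act mu).
Proof.
have qq0 := qBqV_neq0.
split.
- by move=> g a u v; rewrite /Vmu_act mulmxDl scalemxAl.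
- move=> v; split; apply: Vmu_ext => j; rewrite !(Vmu_K, Vmu_Kinv) mulrA.
    by rewrite divff ?mul1r // expfz_neq0.
  by rewrite mulVf ?mul1r // expfz_neq0.
- move=> v; apply: Vmu_ext => j; rewrite Vmu_Z Vmu_K !Vmu_E Vmu_K.
  have [ltj|lej] := ltnP j mu; last first.
    by rewrite (_ : (mu - j = 0)%N) ?qint0 ?(mul0r, mulr0) //; lia.
  rewrite inordK // [in LHS]mulrCA [in RHS]mulrCA; congr (_ * _).
  rewrite mulrA; congr (_ * _).
  by rewrite -[q ^+ 2]/(q ^ 2%:Z) -expfzDr //; congr (_ ^ _); lia.
- move=> v; apply: Vmu_ext => j; rewrite Vmu_Z Vmu_K !Vmu_F Vmu_K.
  have [->|j_gt0] := posnP j; first by rewrite qint0 !(mul0r, mulr0).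
  rewrite inordK; last by have := ltn_ord j; lia.
  rewrite [in LHS]mulrCA [in RHS]mulrCA; congr (_ * _).
  rewrite mulrA; congr (_ * _).
  rewrite -[q ^- 2]/(q ^ (- 2%:Z)) -expfzDr //; congr (_ ^ _); lia.
move=> v; apply: Vmu_ext => j; rewrite Vmu_Z !Vmu_B.
rewrite Vmu_E Vmu_F Vmu_F Vmu_E Vmu_K Vmu_Kinv.
have jmu : (j <= mu)%N by have := ltn_ord j; lia.
have -> : qint (mu - j) * (qint (inord j.+1 : 'I_mu.+1) *
            v 0 (inord (inord j.+1 : 'I_mu.+1).-1)) =
          qint (mu - j) * qint j.+1 * v 0 j.
  have [ltj|lej] := ltnP j mu.
    by rewrite inordK //= inord_val mulrA.
  by rewrite (_ : (mu - j = 0)%N) ?qint0 ?mul0r //; lia.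
have -> : qint j * (qint (mu - (inord j.-1 : 'I_mu.+1)) *
            v 0 (inord (inord j.-1 : 'I_mu.+1).+1)) =
          qint j * qint (mu - j).+1 * v 0 j.
  have [->|j_gt0] := posnP j; first by rewrite qint0 !mul0r.
  rewrite inordK; last by lia.
  by rewrite prednK // inord_val mulrA (_ : (mu - j.-1)%N = (mu - j).+1) //; lia.
rewrite -!mulrBl [in RHS]mulrA; congr (_ * _).
have -> : q ^ (mu%:Z - (2 * j)%N%:Z) = q ^+ (mu - j) / q ^+ j.
  by rewrite -[q ^+ (mu - j)]/(q ^ (mu - j)%N%:Z) -[q ^+ j]/(q ^ j%:Z) invr_expz
    -expfzDr //; congr (_ ^ _); lia.
have x0 : q ^+ j != 0 by rewrite expf_neq0.
have y0 : q ^+ (mu - j) != 0 by rewrite expf_neq0.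
rewrite /qint !exprS; move: (q ^+ j) (q ^+ (mu - j)) x0 y0 => x y x0 y0.
have q20 : q * q - 1 != 0 by rewrite subr_eq0 -expr2 qX_neq1.
by field; rewrite x0 y0 q_neq0 q20.
Qed.

Lemma Vmu_irreducible mu : Uq_irreducible (@Vmu_act mu).
Proof.
split=> [|U stU]; first by rewrite dimvf /dim /= mul1n.
have [->|U0] := eqVneq U 0%VS; [by left | right].
pose e (i : 'I_mu.+1) : Vmu mu := delta_mx 0 i.
have eE i j : e i 0 j = (j == i)%:R by rewrite mxE eqxx.
have e0U n (u : Vmu mu) : u \in U -> (n <= mu)%N -> u 0 (inord n) != 0 ->
    (forall j : 'I_mu.+1, (n < j)%N -> u 0 j = 0) -> e ord0 \in U.
  elim: n u => [|n IHn] u uU len un0 u_above.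
    have i0 : inord 0 = ord0 :> 'I_mu.+1 by apply: val_inj; rewrite /= inordK.
    rewrite i0 in un0.
    have -> : e ord0 = (u 0 ord0)^-1 *: u; last exact: memvZ.
    apply: Vmu_ext => j; rewrite Vmu_Z eE; case: eqVneq => [->|j0].
      by rewrite mulVf.
    by rewrite (u_above j) ?mulr0 // lt0n.
  apply: (IHn (Vmu_act gE u)) => [|||j ltj]; first exact: stU.
  - exact: ltnW.
  - rewrite Vmu_E inordK; last by rewrite ltnS ltnW.
    by rewrite mulf_neq0 // qint_neq0 // subn_gt0.
  rewrite Vmu_E; have [ltj'|lej] := ltnP j mu.
    by rewrite u_above ?mulr0 // inordK.
  by rewrite (_ : (mu - j = 0)%N) ?qint0 ?mul0r //; lia.
have {}e0U : e ord0 \in U.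
  have u0 : vpick U != 0 by rewrite vpick0.
  have [i ui] : exists i, vpick U 0 i != 0.
    apply/existsP; apply: contraNT u0 => /existsPn u0.
    by apply/eqP/Vmu_ext => i; rewrite [RHS]mxE; apply/eqP; rewrite -[_ == _]negbK u0.
  have [n un max_n] := @arg_maxnP _ i (fun j => vpick U 0 j != 0) (fun j => j : nat) ui.
  apply: (e0U n (vpick U)); rewrite ?memv_pick ?inord_val //.
    by rewrite -ltnS.
  move=> j ltj; apply/eqP; apply: contraTT ltj => uj.
  by rewrite -leqNgt; apply: max_n.
have eU n : (n <= mu)%N -> e (inord n) \in U.
  elim: n => [_|n IHn ltn].
    suff -> : inord 0 = ord0 :> 'I_mu.+1 by [].
    by apply: val_inj; rewrite /= inordK.
  have -> : e (inord n.+1) = (qint n.+1)^-1 *: Vmu_act gF (e (inord n)).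
    apply: Vmu_ext => j; rewrite Vmu_Z Vmu_F !eE.
    have [->|neq] := eqVneq j (inord n.+1).
      by rewrite inordK // eqxx mulr1 mulVf // qint_neq0.
    have [j0|j_gt0] := posnP j; first by rewrite j0 qint0 mul0r mulr0.
    case: eqP => [eq_j|_]; last by rewrite !mulr0.
    case/eqP: neq; apply: val_inj; move/(congr1 val): eq_j.
    rewrite /= !inordK //; [|lia|by have := ltn_ord j; lia].
    by move=> eq_j; rewrite -eq_j prednK.
  by apply/memvZ/stU/IHn/ltnW.
apply/eqP; rewrite eqEsubv subvf; apply/subvP => v _.
rewrite (matrix_sum_delta v) big_ord1; apply: memv_suml => i _.
by rewrite -(inord_val i); apply/memvZ/eU; rewrite -ltnS.
Qed.

Lemma Vmu_highest_weight mu : exists v : Vmu mu,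
  [/\ v != 0, Vmu_act gE v = 0 & Vmu_act gK v = q ^+ mu *: v].
Proof.
exists (delta_mx 0 ord0); split.
- apply/eqP => /(congr1 (fun v : 'rV__ => v 0 ord0)).
  by rewrite !mxE !eqxx => /eqP; rewrite oner_eq0.
- apply: Vmu_ext => j; rewrite Vmu_E [RHS]mxE [_ 0 _]mxE eqxx /=.
  have [ltj|lej] := ltnP j mu.
    by rewrite -val_eqE /= inordK // mulr0.
  by rewrite (_ : (mu - j = 0)%N) ?qint0 ?mul0r //; lia.
apply: Vmu_ext => j; rewrite Vmu_Z Vmu_K ![delta_mx _ _ _ _]mxE eqxx /=.
by case: eqP => [->|_]; rewrite ?mulr0 // muln0 subr0.
Qed.

End Vmu_theory.

End Representations.

Local Notation "x %:F" := (FracField.tofrac x).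

(** * The ground field C(q) *)

Definition Cq (R : realType) : fieldType := {fraction {poly R[i]%C}}.

Definition q {R : realType} : Cq R := 'X%:F.

Lemma q_neq0 (R : realType) : q != 0 :> Cq R.
Proof. by rewrite /q tofrac_eq0 polyX_eq0. Qed.

Lemma qX_neq1 (R : realType) n : (0 < n)%N -> q ^+ n != 1 :> Cq R.
Proof.
move=> n_gt0; rewrite /q -tofracXn -tofrac1 tofrac_eq -subr_eq0.
by rewrite -size_poly_eq0 size_XnsubC.
Qed.

Lemma Vmu_spec (R : realType) (mu : nat) :
  [/\ is_Uq_module q (@Vmu_act (Cq R) q mu),
      Uq_irreducible (@Vmu_act (Cq R) q mu),
      \dim {:Vmu (Cq R) mu} = mu.+1
    & exists v : Vmu (Cq R) mu,
        [/\ v != 0, Vmu_act q gE v = 0 & Vmu_act q gK v = q ^+ mu *: v]].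
Proof.
split.
- exact: Vmu_module (@qX_neq1 R) (q_neq0 R) mu.
- exact: Vmu_irreducible (@qX_neq1 R) (q_neq0 R) mu.
- by rewrite dimvf /dim /= mul1n.
exact: Vmu_highest_weight (q_neq0 R) mu.
Qed.

(** * Generic point counts

    [count F n] reads "the set in question has [n] points over [F]".  The
    value is [P(q^2)], where [P] is the polynomial such that the number of
    points over [F] is [P(#|F|)], for every finite field [F]. *)

Definition chi {R : realType} (count : finFieldType -> nat -> Prop) : Cq R :=
  let P := xget 0 [set P : {poly R[i]%C} |
                    forall (F : finFieldType) (n : nat),
                      count F n -> P.[#|F|%:R] = n%:R]%classic in
  (P \Po 'X^2)%:F.

(** A family of finite sets of points, one for each finite-dimensional space
    over each finite field, cut into strata.  The labels of the strata do not
    depend on the field: "the same linear-algebra condition over another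
    field" means "the same label". *)

Record family := Family {
  points :> forall F : finFieldType, vectType F -> finType;
  label_type : eqType;
  label : forall (F : finFieldType) (V : vectType F), points V -> label_type
}.

Section Functions.
Variables (R : realType) (X : family) (F : finFieldType) (V : vectType F).

Definition functions := {ffun X F V -> (Cq R)^o}.

Definition labels : seq (label_type X) := undup [seq label x | x : X F V].

Definition indic (m : label_type X) : functions := [ffun x => (label x == m)%:R].

(** The span of the indicator functions of the strata; the empty ones are
    omitted. *)
Definition strata_span : {vspace functions} := <<[seq indic m | m <- labels]>>%VS.

(** The value of [f] on the stratum [m]; meaningful if [f] is constant there. *)
Definition value_on (f : functions) (m : label_type X) : Cq R :=
  if [pick x | label x == m] is Some x then f x else 0.

End Functions.

(** The sum of [f y] over the points [y] such that [Z x y], where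
    [f = \sum_m c_m 1_m] is a combination of indicator functions of strata: the
    set of the [y] in the stratum [m] such that [Z x y] contributes [c_m] times
    its [chi], its numbers of points being taken over all finite fields [F']
    and at all points [x'] with the same label as [x]. *)
Definition gsum (R : realType) (X Y : family)
    (Z : forall (F : finFieldType) (V : vectType F), X F V -> Y F V -> bool)
    (F : finFieldType) (V : vectType F) (f : functions R Y V) (x : X F V) : Cq R :=
  \sum_(m <- labels Y V) value_on f m *
    chi (fun F' n => exists (V' : vectType F') (x' : X F' V'),
           [/\ \dim {:V'} = \dim {:V}, label x' = label x
             & n = #|[set y : Y F' V' | Z F' V' x' y & label y == m]|]).

(** * The varieties *)

(** The pairs [(W, t)], with strata the [M^r(w, d)], labelled by [(w, r)]. *)

Section PointsM.
Variables (F : finFieldType) (D : vectType F).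

Definition in_M (x : {vspace D} * 'End(D)) : bool :=
  (limg x.2 <= x.1)%VS && (x.1 <= lker x.2)%VS.

Definition M_points : finType := {x : {vspace D} * 'End(D) | in_M x}.

Definition spW (x : M_points) : {vspace D} := (val x).1.
Definition endt (x : M_points) : 'End(D) := (val x).2.

Definition M_label (x : M_points) : nat * nat := (\dim (spW x), \dim (limg (endt x))).

(** [M_up x y] selects the [y = (U, t)] over which [E] sums at [x = (W, t)], and
    [M_down x y] those over which [F] sums; [in_M y] gives the inclusions of
    [U] in [lker t] and of [limg t] in [U]. *)
Definition M_up (x y : M_points) : bool :=
  [&& endt y == endt x, (spW x <= spW y)%VS & \dim (spW y) == (\dim (spW x)).+1].

Definition M_down (x y : M_points) : bool :=
  [&& endt y == endt x, (spW y <= spW x)%VS & (\dim (spW y)).+1 == \dim (spW x)].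

End PointsM.

Definition M_family : family := @Family M_points _ M_label.

(** The triples [(DD, W, t)], with strata the [A_{w, r, n}], labelled by
    [(w, r, n)]. *)

Section PointsT.
Variables (k : nat) (dd : {ffun 'I_k -> nat}).
Variables (F : finFieldType) (D : vectType F).

Definition flag := {ffun 'I_k.+1 -> {vspace D}}.

(** For [i : 'I_k], the two steps [D_(i-1)] and [D_i] of the flag around the
    [i]-th subquotient, the indices of the subquotients starting from 1 in
    this notation and from 0 in ['I_k]. *)
Definition step_lo (DD : flag) (i : 'I_k) : {vspace D} := DD (widen_ord (leqnSn k) i).
Definition step_hi (DD : flag) (i : 'I_k) : {vspace D} := DD (lift ord0 i).

Definition is_flag (DD : flag) : bool :=
  [&& DD ord0 == 0%VS, DD ord_max == fullv
    & [forall i, (step_lo DD i <= step_hi DD i)%VS &&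
                 (\dim (step_hi DD i) == \dim (step_lo DD i) + dd i)%N]].

Definition alpha (X : {vspace D}) (DD : flag) : {ffun 'I_k -> nat} :=
  [ffun i => (\dim (X :&: step_hi DD i) - \dim (X :&: step_lo DD i))%N].

Definition in_T (x : flag * M_points D) : bool :=
  is_flag x.1 && [forall i, (endt x.2 @: step_hi x.1 i <= step_lo x.1 i)%VS].

Definition T_points : finType := {x : flag * M_points D | in_T x}.

Definition T_flag (x : T_points) : flag := (val x).1.
Definition T_proj (x : T_points) : M_points D := (val x).2.

Definition alpha_ker (x : T_points) := alpha (lker (endt (T_proj x))) (T_flag x).

Definition T_label (x : T_points) :
    {ffun 'I_k -> nat} * {ffun 'I_k -> nat} * {ffun 'I_k -> nat} :=
  (alpha (spW (T_proj x)) (T_flag x),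
   alpha (limg (endt (T_proj x))) (T_flag x),
   alpha_ker x).

Definition T_up (x y : T_points) : bool :=
  (T_flag y == T_flag x) && M_up (T_proj x) (T_proj y).

Definition T_down (x y : T_points) : bool :=
  (T_flag y == T_flag x) && M_down (T_proj x) (T_proj y).

End PointsT.

Definition T_family (k : nat) (dd : {ffun 'I_k -> nat}) : family :=
  @Family (@T_points k dd) _ (@T_label k dd).

(** * The actions of U_q on functions *)

Definition act_on (R : realType) (X : family)
    (pr : forall (F : finFieldType) (D : vectType F), X F D -> M_points D)
    (up down : forall (F : finFieldType) (D : vectType F), X F D -> X F D -> bool)
    (F : finFieldType) (D : vectType F) : action (functions R X D) :=
  fun g f => [ffun x =>
    let d := (\dim {:D})%:Z in
    let w := (\dim (spW (pr F D x)))%:Z in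
    let r := (\dim (limg (endt (pr F D x))))%:Z in
    let n := (\dim (lker (endt (pr F D x))))%:Z in
    match g with
    | gE => q ^ (- (n - w - 1)) * gsum up f x
    | gF => q ^ (- (w - r - 1)) * gsum down f x
    | gK => q ^ (d - 2 * w) * f x
    | gKinv => q ^ (- (d - 2 * w)) * f x
    end].

Definition act_M (R : realType) (F : finFieldType) (D : vectType F) :
    action (functions R M_family D) :=
  @act_on R M_family (fun F D x => x) M_up M_down F D.

Definition act_T (R : realType) (k : nat) (dd : {ffun 'I_k -> nat})
    (F : finFieldType) (D : vectType F) : action (functions R (T_family dd) D) :=
  @act_on R (T_family dd) (@T_proj k dd) (@T_up k dd) (@T_down k dd) F D.

(** * The function spaces *)

Definition calT (R : realType) (k : nat) (dd : {ffun 'I_k -> nat})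
    (F : finFieldType) (D : vectType F) : {vspace functions R (T_family dd) D} :=
  strata_span R (T_family dd) D.

Definition calMr (R : realType) (F : finFieldType) (D : vectType F) (r : nat) :
    {vspace functions R M_family D} :=
  (\sum_(w < (\dim {:D}).+1) <[indic R (X := M_family) D (w : nat, r)]>)%VS.

Definition calM (R : realType) (F : finFieldType) (D : vectType F) :
    {vspace functions R M_family D} :=
  (\sum_(r < (\dim {:D}).+1) calMr R D r)%VS.

(** * The maps T_Y *)

Definition pushforward (R : realType) (k : nat) (dd : {ffun 'I_k -> nat})
    (F : finFieldType) (D : vectType F) (f : functions R (T_family dd) D) :
    functions R M_family D :=
  [ffun x => gsum (X := M_family) (Y := T_family dd)
               (fun F D x y => T_proj y == x) f x].

(** [T_Y] for [Y] the set of points [(DD, W, t)] with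
    [alpha (lker t) DD = n]. *)
Definition T_map (R : realType) (k : nat) (dd n : {ffun 'I_k -> nat})
    (F : finFieldType) (D : vectType F) (f : functions R (T_family dd) D) :
    functions R M_family D :=
  pushforward [ffun y : T_family dd F D => (alpha_ker y == n)%:R * f y].

(** * Lower crossingless matches *)

Section Matches.
Variables (k : nat) (dd : {ffun 'I_k -> nat}).

Definition vertex := {i : 'I_k & 'I_(dd i)}.

Definition vlt (u v : vertex) : bool :=
  (tag u < tag v)%N || ((tag u == tag v) && (tagged u < tagged v)%N).

(** An arc is the pair of its left and right endpoints. *)
Implicit Type b : {set vertex * vertex}.

Definition endpoint (v : vertex) (a : vertex * vertex) : bool :=
  (v == a.1) || (v == a.2).

Definition unmatched b : {set vertex} :=
  [set v | [forall a in b, ~~ endpoint v a]].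

Definition lower_crossingless b : Prop :=
  [/\ forall a, a \in b -> vlt a.1 a.2 /\ tag a.1 != tag a.2,
      forall v a a', a \in b -> a' \in b -> endpoint v a -> endpoint v a' -> a = a',
      forall a a', a \in b -> a' \in b -> ~~ [&& vlt a.1 a'.1, vlt a'.1 a.2 & vlt a.2 a'.2]
    & forall v a, v \in unmatched b -> a \in b -> ~~ (vlt a.1 v && vlt v a.2)].

Definition nvec b : {ffun 'I_k -> nat} :=
  [ffun i => (dd i - #|[set a in b | tag a.2 == i]|)%N].

End Matches.

(* Main.v *)
(** Every sum over points is taken with the multiplicities [chi], so the point is
    that the relevant point counts are polynomials in [#|F|] with coefficients in
    [nat] which depend only on the labels.  All of them reduce to one count: the
    subspaces [Y] between two given subspaces whose intersections with the members
    of a chain have prescribed dimensions.  The neighbours [U] of [W] are such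
    subspaces for the chain cut out by the flag; the flags above a point [(W, t)]
    are built step by step, [D_i] lying between [D_(i-1)] and [t^-1(D_(i-1))], whose
    dimension is [dim ker t + dim (im t :&: D_(i-1))], with prescribed
    intersections with [im t], [W] and [ker t].  Hence identities between generic
    sums follow from double counting over infinitely many fields, and moving [W]
    commutes with forgetting the flag because the condition on flags involves only
    [t].  Fixing [alpha (ker t)] fixes the rank of [t], which is the number of arcs. *)

Require Import Defs.
From mathcomp Require Import all_boot all_order all_algebra finfield.
From mathcomp Require Import reals complex.
From mathcomp Require Import ring zify.
Set Implicit Arguments.
Unset Strict Implicit.
Unset Printing Implicit Defensive.
Import Order.TTheory GRing.Theory Num.Theory.
Local Open Scope ring_scope.

(** * Gaussian binomials and extensions of subspaces *)

(** The Gaussian binomial, defined by the q-Pascal rule so that its coefficients lie in [nat], as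
    [natpoly_eq0] requires. *)
Fixpoint gauss (n k : nat) : {poly nat} :=
  match n, k with
  | _, 0 => 1
  | 0, _.+1 => 0
  | n.+1, k.+1 => gauss n k + 'X^(k.+1) * gauss n k.+1
  end.

Lemma gauss0 n : gauss n 0 = 1.
Proof. by case: n. Qed.

Lemma gauss1 n : gauss n 1 = \sum_(i < n) 'X^i.
Proof.
elim: n => [|n IHn]; first by rewrite big_ord0.
rewrite big_ord_recl /= gauss0 expr0 expr1 IHn; congr (_ + _).
by rewrite big_distrr; apply: eq_bigr => i _; rewrite /bump add1n exprS.
Qed.

Lemma prod_qsubS (Q : int) m l :
  \prod_(j < l.+1) (Q ^+ m.+1 - Q ^+ j) =
  (Q ^+ m.+1 - 1) * Q ^+ l * \prod_(j < l) (Q ^+ m - Q ^+ j).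
Proof.
rewrite big_ord_recl expr0 -mulrA; congr (_ * _).
under eq_bigr do rewrite /= /bump add1n !exprS -mulrBr.
by rewrite big_split prodr_const card_ord.
Qed.

(** The product formula with denominators cleared, over [int] because of the subtractions. Peeling
    one factor off each product by [prod_qsubS] turns the Pascal rule into a ring identity. *)
Lemma gauss_prod (Q : int) n k :
  (map_poly (GRing.natmul 1) (gauss n k)).[Q] * \prod_(j < k) (Q ^+ k - Q ^+ j) =
  \prod_(j < k) (Q ^+ n - Q ^+ j).
Proof.
elim: n k => [|n IHn] [|k]; rewrite ?big_ord0 ?gauss0 /=.
- by rewrite rmorph1 hornerC mulr1.
- by rewrite rmorph0 horner0 mul0r big_ord_recl subrr mul0r.
- by rewrite rmorph1 hornerC mulr1.
rewrite rmorphD rmorphM /= map_polyXn hornerD hornerM hornerXn mulrDl -mulrA IHn.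
rewrite !prod_qsubS mulrCA IHn [in X in _ + X = _]big_ord_recr /= !exprS.
ring.
Qed.

(** Two instances of [gauss_prod] share a product that is nonzero for [Q > 1] and can be cancelled.
    This is the ratio produced by the double count in [card_extensions]. *)
Lemma gauss_absorb (Q n k : nat) : (1 < Q)%N ->
  ((gauss n.+1 k.+1).[Q] * (Q ^ k.+1 - 1) = (gauss n k).[Q] * (Q ^ n.+1 - 1))%N.
Proof.
move=> Q_gt1; apply/eqP; rewrite -eqz_nat !PoszM.
have Qm m : ((Q ^ m - 1)%N = Q%:Z ^+ m - 1 :> int).
  by rewrite -subzn ?expn_gt0 ?(ltnW Q_gt1) // -[(Q ^ m)%N]/(Q ^+ m : nat) rmorphXn.
have gE m l : Posz (gauss m l).[Q] = (map_poly (GRing.natmul 1) (gauss m l)).[Q%:Z].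
  rewrite -[Q%:Z]natz; apply: esym.
  by etransitivity; [apply: (horner_map (GRing.natmul 1)) | apply: natz].
have := gauss_prod Q%:Z n.+1 k.+1; rewrite !prod_qsubS -(gauss_prod Q%:Z n k) !Qm !gE.
have Q0 : Q%:Z ^+ k != 0 by rewrite expf_neq0 // eqz_nat -lt0n (ltnW Q_gt1).
have P0 : \prod_(j < k) (Q%:Z ^+ k - Q%:Z ^+ j) != 0.
  apply/prodf_neq0 => j _; rewrite subr_eq0 -!rmorphXn /= eqz_nat.
  by rewrite eqn_exp2l // neq_ltn ltn_ord orbT.
move=> eqg; apply/eqP; apply: (mulIf Q0); apply: (mulIf P0).
by rewrite -!mulrA in eqg *; rewrite eqg; ring.
Qed.

Lemma card_memv (F : finFieldType) (V : vectType F) (U : {vspace V}) :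
  #|[set v : finvect_type V | v \in U]| = (#|F| ^ \dim U)%N.
Proof. by case: V U => T c U; rewrite cardsE; apply: (@card_vspace F (finvect_type _)). Qed.

Section Extensions.
Variables (F : finFieldType) (V : vectType F).
Implicit Types B C E U W Y : {vspace V}.

Let Q_gt1 : (1 < #|F|)%N. Proof. exact: finNzRing_gt1. Qed.

Lemma card_memvD U W : (U <= W)%VS ->
  #|[set v : finvect_type V | (v \in W) && (v \notin U)]| =
  (#|F| ^ \dim W - #|F| ^ \dim U)%N.
Proof.
move=> UW; rewrite -!card_memv.
rewrite -(cardsID [set v : finvect_type V | v \in U] [set v : finvect_type V | v \in W]).
rewrite (_ : _ :&: _ = [set v : finvect_type V | v \in U]) ?addKn.
  by apply: eq_card => v; rewrite !inE andbC.
by apply/setP => v; rewrite !inE andb_idl //; apply: (subvP UW).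
Qed.

Lemma capv_line0 U v : v \notin U -> (U :&: <[v]> = 0)%VS.
Proof.
move=> vU; apply/eqP; rewrite -subv0; apply/subvP => w /memv_capP[wU /vlineP[c wE]].
move: wU; rewrite wE memv0; have [->|c0] := eqVneq c 0; first by rewrite scale0r.
by move/(memvZ c^-1); rewrite scalerA mulVf // scale1r (negPf vU).
Qed.

Lemma dim_addv_line U v : v \notin U -> \dim (U + <[v]>) = (\dim U).+1.
Proof.
move=> vU; have v0 : v != 0 by apply: contraNneq vU => ->; exact: mem0v.
have := dimv_sum_cap U <[v]>; rewrite dim_vline v0 capv_line0 // dimv0; lia.
Qed.

(** With [E = B] these are all subspaces between [B] and [C] of the given dimension, the case used
    for the moves of [W] on [M(d)]. A larger [E] is needed for chains. *)
Definition extensions s B E C : {set {vspace V}} :=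
  [set Y | [&& (Y <= C)%VS, (Y :&: E == B)%VS & \dim Y == (\dim B + s)%N]].

(** [extensions] is counted by double counting the pairs of [Y] and [v \in Y]
    outside [B]. *)
Lemma extensions_line s B E C v Y : (B <= E)%VS -> (E <= C)%VS ->
  [&& v \in C, v \notin E & Y \in extensions s (B + <[v]>) (E + <[v]>) C] =
  [&& Y \in extensions s.+1 B E C, v \in Y & v \notin B].
Proof.
move=> BE EC; rewrite !inE; apply/and3P/and3P.
  move=> [vC vE /and3P[YC /eqP YEv dimY]].
  have vB : v \notin B by apply: contra vE; apply: (subvP BE).
  have vY : v \in Y.
    have : v \in (B + <[v]>)%VS by rewrite (subvP (addvSr _ _)) ?memv_line.
    by rewrite -YEv => /memv_capP[].
  split=> //; rewrite YC (eqP dimY) dim_addv_line // addSnnS eqxx andbT /=.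
  have -> : (Y :&: E = Y :&: (E + <[v]>) :&: E)%VS.
    by rewrite -capvA; congr (_ :&: _)%VS; apply/esym/capv_idPr/addvSl.
  by rewrite YEv -vspace_modl // [(<[v]> :&: E)%VS]capvC capv_line0 // addv0.
move=> [/and3P[YC /eqP YE dimY] vY vB].
split; first exact: (subvP YC).
  by apply: contra vB => vE; rewrite -YE memv_cap vY.
rewrite YC dim_addv_line // addSnnS dimY andbT /=.
by rewrite -vspace_modr ?YE // -memvE.
Qed.

Lemma card_extensions s B E C : (B <= E)%VS -> (E <= C)%VS ->
  #|extensions s B E C| =
  (#|F| ^ ((\dim E - \dim B) * s) * (gauss (\dim C - \dim E) s).[#|F|])%N.
Proof.
elim: s B E => [|s IHs] B E BE EC.
  rewrite muln0 gauss0 hornerC muln1 (_ : extensions _ _ _ _ = [set B]) ?cards1 //.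
  apply/setP => Y; rewrite !inE addn0; apply/and3P/eqP.
    move=> [_ /eqP YE dimY]; apply/eqP; rewrite eq_sym eqEdim (eqP dimY) leqnn andbT.
    by rewrite -YE capvSl.
  by move=> ->; rewrite (subv_trans BE EC) (capv_idPl BE) !eqxx.
have count_pairs : (#|extensions s.+1 B E C| * (#|F| ^ (\dim B + s.+1) - #|F| ^ \dim B) =
    \sum_(v : finvect_type V | (v \in C) && (v \notin E))
       #|extensions s (B + <[v : V]>) (E + <[v : V]>) C|)%N.
  rewrite -sum_nat_const; transitivity (\sum_(Y in extensions s.+1 B E C)
      \sum_(v : finvect_type V | (v \in Y) && (v \notin B)) 1)%N.
    apply: eq_bigr => Y; rewrite inE => /and3P[YC /eqP YE /eqP dimY].
    rewrite sum1_card -dimY -card_memvD; last by rewrite -YE capvSl.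
    by apply: eq_card => v; rewrite !inE.
  rewrite (exchange_big_dep (fun v : finvect_type V => (v \in C) && (v \notin E))) /=.
    apply: eq_bigr => v /andP[vC vE]; rewrite sum1_card; apply: eq_card => Y.
    by rewrite -[LHS]extensions_line // vC vE.
  move=> Y v; rewrite inE => /and3P[YC /eqP YE _] /andP[vY vB].
  rewrite (subvP YC) //=; apply: contra vB => vE; rewrite -YE.
  by apply/(@memv_capP _ _ (v : V)); split.
have := dimvS BE; have := dimvS EC; move: count_pairs.
(* By the induction hypothesis every [v] contributes the same number [K]: adding the line of [v]
   raises both dimensions by one and keeps their difference. *)
set K := (#|F| ^ ((\dim E - \dim B) * s) * (gauss (\dim C - (\dim E).+1) s).[#|F|])%N.
have sumK : (\sum_(v : finvect_type V | (v \in C) && (v \notin E)) K =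
    (#|F| ^ \dim C - #|F| ^ \dim E) * K)%N.
  rewrite sum_nat_const -card_memvD //; congr (_ * _)%N.
  by apply: eq_card => v; rewrite !inE.
rewrite (eq_bigr (fun=> K)) ?{}sumK /K; last first.
  move=> v /andP[vC vE]; rewrite IHs ?addvS //; last by rewrite subv_add EC -memvE.
  rewrite !dim_addv_line //; by [|apply: contra vE; apply: (subvP BE)].
move: (\dim B) (\dim E) (\dim C) => nB nE nC count_pairs le_EC le_BE.
have pos m : (0 < #|F| ^ m)%N by rewrite expn_gt0 (ltnW Q_gt1).
have pos1 : (0 < #|F| ^ s.+1 - 1)%N by rewrite subn_gt0 -(expn0 #|F|) ltn_exp2l.
have expB i j : (#|F| ^ (i + j) - #|F| ^ i = #|F| ^ i * (#|F| ^ j - 1))%N.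
  by rewrite mulnBr muln1 expnD.
apply/eqP; rewrite -(eqn_pmul2r pos1) -(eqn_pmul2l (pos nB)).
rewrite mulnCA -expB {}count_pairs; apply/eqP.
have [m Em] : exists m, nE = (nB + m)%N by exists (nE - nB)%N; lia.
have [n En] : exists n, nC = (nE + n)%N by exists (nC - nE)%N; lia.
(* If [C] and [E] have equal dimension, no vector of [C] lies outside [E] and both sides are 0. *)
move: En; rewrite {}Em => ->; case: n => [|n].
  by rewrite addn0 !subnn /= horner0 muln0 !mul0n muln0.
have -> : (nB + m + n.+1 - (nB + m).+1 = n)%N by lia.
rewrite expB !addKn -[X in _ = (_ * X)%N]mulnA gauss_absorb //.
rewrite expnD mulnS expnD; ring.
Qed.

(** Here [c], [b], [y] are the dimensions of [C i], [B :&: C i] and [Y :&: C i]. Factor [i] counts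
    the ways to extend [Y :&: C i] to [Y :&: C i.+1], which must contain the sum of [Y :&: C i] and
    [B :&: C i.+1], of dimension [j]. The test on [j] matters: truncated subtraction would turn an
    impossible dimension into an extension by 0, counted once. *)
Definition chain_poly (c b y : nat -> nat) (m : nat) : {poly nat} :=
  \prod_(i < m)
    let j := (y i + (b i.+1 - b i))%N in
    if (j <= y i.+1)%N then
      'X^((c i - y i) * (y i.+1 - j)) *
      gauss (c i.+1 - (c i + (b i.+1 - b i))) (y i.+1 - j)
    else 0.

(** The lower bound is only [B :&: C m], so that intersecting with a smaller member of the chain
    gives a set of the same kind. *)
Definition chain_spaces (C : nat -> {vspace V}) B (y : nat -> nat) m :
    {set {vspace V}} :=
  [set Y | [&& (B :&: C m <= Y)%VS, (Y <= C m)%VS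
             & [forall i : 'I_m.+1, \dim (Y :&: C i) == y i]]].

Lemma chain_sub (C : nat -> {vspace V}) m :
  (forall i, (i < m)%N -> (C i <= C i.+1)%VS) ->
  forall i, (i <= m)%N -> (C i <= C m)%VS.
Proof.
elim: m => [|m IHm] subC i; first by rewrite leqn0 => /eqP ->; exact: subvv.
rewrite leq_eqVlt => /predU1P[->|lti]; first exact: subvv.
apply: (subv_trans (IHm _ i lti) (subC m (ltnSn m))) => j ltj.
by apply: subC; apply: ltnW.
Qed.

Lemma card_chain_spaces (C : nat -> {vspace V}) B (y : nat -> nat) m :
  C 0 = 0%VS -> y 0 = 0%N -> (forall i, (i < m)%N -> (C i <= C i.+1)%VS) ->
  #|chain_spaces C B y m| =
  (chain_poly (fun i => \dim (C i)) (fun i => \dim (B :&: C i)) y m).[#|F|].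
Proof.
move=> C0 y0; elim: m => [|m IHm] subC.
  rewrite /chain_poly big_ord0 hornerC (_ : chain_spaces _ _ _ _ = [set 0%VS]) ?cards1 //.
  apply/setP => Y; rewrite !inE C0 capv0 sub0v subv0 /= andb_idr // => /eqP ->.
  by apply/forallP => i; rewrite (ord1 i) cap0v y0 dimv0.
have {}IHm := IHm (fun i lti => subC i (ltnW lti)).
have subCm : (C m <= C m.+1)%VS by exact: subC.
rewrite /chain_poly big_ord_recr hornerM -/(chain_poly _ _ _ m) -{}IHm.
set j := (y m + _)%N.
set step := (if _ then _ else _).
transitivity (\sum_(Y in chain_spaces C B y m) step.[#|F|])%N; last by rewrite sum_nat_const.
rewrite -sum1_card.
(* Group the [Y] by their trace [Y'] on [C m]; each group is a set of extensions whose size does not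
   depend on [Y']. *)
rewrite (partition_big (fun Y => Y :&: C m)%VS (mem (chain_spaces C B y m))) /=; last first.
  move=> Y; rewrite !inE => /and3P[BY YC /forallP dimY].
  rewrite capvSr subv_cap capvSr andbT /=; apply/andP; split.
    by apply: subv_trans BY; apply: capvS.
  apply/forallP => i.
  have iC : (C i <= C m)%VS.
    by apply: (@chain_sub C m) => [l ltl|]; [apply: subC; apply: ltnW | rewrite -ltnS].
  by rewrite -capvA (capv_idPr iC); apply: (dimY (widen_ord (leqnSn _) i)).
apply: eq_bigr => Y'; rewrite inE => /and3P[BY' Y'C /forallP dimY'].
have dimY'm : \dim Y' = y m by have /eqP := dimY' ord_max; rewrite /= (capv_idPl Y'C).
set B' := (B :&: C m.+1)%VS.
have B'C : (B' :&: C m = B :&: C m)%VS by rewrite -capvA (capv_idPr subCm).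
have le_b : (\dim (B :&: C m) <= \dim B')%N by apply/dimvS/capvS.
have dimB : \dim (Y' + B') = j.
  have := dimv_sum_cap Y' B'; rewrite (_ : Y' :&: B' = B :&: C m)%VS ?dimY'm.
    by rewrite /j /= -/B' => ?; lia.
  apply/eqP; rewrite eqEsubv !subv_cap BY' capvSl (subv_trans (capvSr _ _) subCm).
  by rewrite (subv_trans (capvSl _ _) Y'C) (subv_trans (capvSr _ _) (capvSl _ _)).
have dimE : \dim (C m + B') = (\dim (C m) + (\dim B' - \dim (B :&: C m)))%N.
  by have := dimv_sum_cap (C m) B'; rewrite capvC B'C; lia.
(* By the modular law, having trace [Y'] on [C m] and containing [B'] amounts to meeting [C m + B']
   exactly in [Y' + B']. *)
transitivity #|[set Y | [&& (Y <= C m.+1)%VS, (Y :&: (C m + B') == Y' + B')%VS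
                          & \dim Y == y m.+1]]|.
  rewrite sum1_card; apply: eq_card => Y; rewrite !inE; apply/idP/idP.
    rewrite unfold_in inE => /andP[/and3P[BY YC /forallP dimY] /eqP YCm].
    rewrite YC -vspace_modr // YCm eqxx /=.
    by have := dimY ord_max; rewrite /= (capv_idPl YC).
  move=> /and3P[YC /eqP YE /eqP dimY].
  have B'Y : (B' <= Y)%VS.
    by apply: subv_trans (addvSr Y' _) _; rewrite -YE capvSl.
  have YCm : (Y :&: C m)%VS = Y'.
    have -> : (Y :&: C m = Y :&: (C m + B') :&: C m)%VS.
      by rewrite -capvA (capv_idPr (addvSl _ _)).
    by rewrite YE -vspace_modl // B'C (addv_idPl BY').
  rewrite unfold_in inE YCm eqxx B'Y YC /= andbT; apply/forallP => i.
  have [lti|] := ltnP i m.+1.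
    have iC : (C i <= C m)%VS.
      by apply: (@chain_sub C m) => // l ltl; apply: subC; apply: ltnW.
    by rewrite -(capv_idPr iC) capvA YCm; apply: (dimY' (Ordinal lti)).
  have := ltn_ord i; rewrite ltnS => lei gei.
  have -> : nat_of_ord i = m.+1 by apply/eqP; rewrite eqn_leq lei gei.
  by rewrite (capv_idPl YC) dimY.
rewrite {}/step; have [le_j|gt_j] := leqP j (y m.+1).
  have sub1 : (Y' + B' <= C m + B')%VS by rewrite addvS.
  have sub2 : (C m + B' <= C m.+1)%VS by rewrite subv_add subCm capvSr.
  have := card_extensions (y m.+1 - j) sub1 sub2.
  rewrite /extensions dimB dimE subnKC // => ->.
  rewrite hornerM hornerXn; congr (_ ^ (_ * _) * _)%N.
  by rewrite /j subnDr.
(* Such a [Y] would contain [Y' + B'], whose dimension [j] is too large. *)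
rewrite hornerC; apply/eqP; rewrite cards_eq0 -subset0; apply/subsetP => Y.
rewrite inE => /and3P[_ /eqP YE /eqP dimY]; move: gt_j.
by rewrite -dimY -dimB -YE ltnNge dimvS // capvSl.
Qed.

End Extensions.

(** * Counting polynomials and generic sums *)

Lemma poly_eq_unbounded (R : numDomainType) (P Q : {poly R}) :
  (forall N, exists2 n, (N < n)%N & P.[n%:R] = Q.[n%:R]) -> P = Q.
Proof.
move=> PQ; apply/eqP; rewrite -subr_eq0; apply/negPn/negP => PQ0.
have [s [size_s uniq_s root_s]] : exists s : seq nat,
    [/\ size s = size (P - Q), uniq s & all (fun n => root (P - Q) n%:R) s].
  elim: (size _) => [|n [s [size_s uniq_s root_s]]]; first by exists [::].
  (* Exceeding the sum of the roots found so far makes [p] a new one. *)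
  have [p lt_p PQp] := PQ (sumn s); exists (p :: s); split=> /=.
  - by rewrite size_s.
  - rewrite uniq_s andbT; apply: contraL lt_p => ps; rewrite -leqNgt.
    by elim: s ps {size_s uniq_s root_s} => //= a s IHs;
      rewrite inE => /predU1P[->|/IHs]; lia.
  - by rewrite root_s rootE hornerD hornerN PQp subrr eqxx.
have := max_poly_roots PQ0 (rs := [seq n%:R | n <- s]).
rewrite all_map map_inj_uniq => [/(_ root_s uniq_s)|m n /eqP].
  by rewrite size_map size_s ltnn.
by rewrite eqr_nat => /eqP.
Qed.

Lemma natpoly_inj (R : numDomainType) :
  injective (map_poly (GRing.natmul 1) : {poly nat} -> {poly R}).
Proof.
move=> P Q /polyP PQ; apply/polyP => i; have := PQ i.
by rewrite !coef_map /= => /eqP; rewrite eqr_nat => /eqP.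
Qed.

Lemma natpoly_eq_unbounded (P Q : {poly nat}) :
  (forall N, exists2 n, (N < n)%N & P.[n] = Q.[n]) -> P = Q.
Proof.
move=> PQ; apply: (@natpoly_inj int); apply: poly_eq_unbounded => N.
have [n ltn PQn] := PQ N; exists n => //.
have := congr1 (fun m => m%:R : int) PQn.
by rewrite -!(horner_map (GRing.natmul 1)).
Qed.

(** Coefficients in [nat] are what makes non-emptiness of a stratum independent of
    the field. *)
Lemma natpoly_eq0 (P : {poly nat}) n : (0 < n)%N -> P.[n] = 0%N -> P = 0.
Proof.
move=> n_gt0; rewrite horner_coef => /eqP.
rewrite sum_nat_eq0 => /forall_inP P0; apply/polyP => i; rewrite coef0.
have [lti|gei] := ltnP i (size P); last by rewrite nth_default.
have := P0 (Ordinal lti) isT; rewrite /= -[_ == _]/((P`_i)%R * n ^ i == 0)%N.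
by rewrite muln_eq0 [(n ^ i == 0)%N]expn_eq0 [(n == 0)%N]eqn0Ngt n_gt0 orbF => /eqP.
Qed.

(** * Evaluating generic counts at [q ^+ 2] *)

Section ChiTheory.
Variable R : realType.

Definition at_q2 (P : {poly nat}) : Cq R := (map_poly (GRing.natmul 1) P).[q ^+ 2].

Lemma at_q2_0 : at_q2 0 = 0.
Proof. by rewrite /at_q2 rmorph0 horner0. Qed.

Lemma at_q2D P Q : at_q2 (P + Q) = at_q2 P + at_q2 Q.
Proof. by rewrite /at_q2 rmorphD hornerD. Qed.

Lemma at_q2M P Q : at_q2 (P * Q) = at_q2 P * at_q2 Q.
Proof. by rewrite /at_q2 rmorphM hornerM. Qed.

Lemma at_q2_sum I (r : seq I) (p : pred I) (P : I -> {poly nat}) :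
  at_q2 (\sum_(i <- r | p i) P i) = \sum_(i <- r | p i) at_q2 (P i).
Proof. exact: (big_morph at_q2 at_q2D at_q2_0). Qed.

Lemma at_q2E (P : {poly nat}) :
  FracField.tofrac (map_poly (GRing.natmul 1) P \Po 'X^2 : {poly R[i]%C}) = at_q2 P.
Proof.
elim/poly_ind: P => [|P c IHP]; first by rewrite at_q2_0 !rmorph0.
rewrite at_q2D at_q2M /at_q2 !rmorphD !rmorphM /= IHP !map_polyX !map_polyC.
rewrite comp_polyX comp_polyC hornerX hornerC tofracXn /=; congr (_ + _).
by rewrite polyCMn rmorphMn /= tofrac1.
Qed.

(** [chi] picks its polynomial by choice, with default 0. The first hypothesis shows that there is
    one to pick; the second forces the chosen one to agree with [P] at unboundedly many
    cardinalities, hence everywhere. *)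
Lemma chi_eq (count : finFieldType -> nat -> Prop) (P : {poly nat}) :
  (forall F n, count F n -> P.[#|F|] = n) ->
  (forall N, exists (F : finFieldType) n, (N < #|F|)%N /\ count F n) ->
  chi count = at_q2 P.
Proof.
move=> countP count_inf; rewrite -at_q2E /chi; congr FracField.tofrac; congr (_ \Po _).
set A := (X in classical_sets.xget _ X).
have AP : A (map_poly (GRing.natmul 1) P).
  by move=> F n /countP <-; exact: (horner_map (GRing.natmul 1)).
have AQ := classical_sets.xgetI 0 AP; apply: poly_eq_unbounded => N.
have [F [n [ltN Fn]]] := count_inf N; exists #|F| => //.
by rewrite (AQ F n Fn) (AP F n Fn).
Qed.

End ChiTheory.

Lemma large_field (N d : nat) : exists (F : finFieldType) (V : vectType F),
  (N < #|F|)%N /\ \dim {:V} = d.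
Proof.
have [p ltp p_prime] := prime_above N.
exists ('F_p : finFieldType), 'rV['F_p]_d.
by rewrite card_Fp // dimvf /dim /= mul1n.
Qed.

(** This transfers sums over [labels] from one field to another, and provides points of a given
    label over arbitrarily large fields, as [chi_eq] needs. *)
Definition stable (X : Defs.family) :=
  forall (F : finFieldType) (V : vectType F) (x : X F V)
    (F' : finFieldType) (V' : vectType F'),
  \dim {:V'} = \dim {:V} -> exists x' : X F' V', label x' = label x.

Definition relation_on (X Y : Defs.family) :=
  forall (F : finFieldType) (V : vectType F), X F V -> Y F V -> bool.

Definition counted (X Y : Defs.family) (Z : relation_on X Y) (d : nat)
    (P : label_type X -> label_type Y -> {poly nat}) :=
  forall (F : finFieldType) (V : vectType F) (x : X F V) m, \dim {:V} = d ->
    #|[set y : Y F V | Z F V x y & label y == m]| = (P (label x) m).[#|F|].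

(** * Scaling and composition of generic sums *)

Section GenericSums.
Variable R : realType.

Lemma mem_labels (X : Defs.family) (F : finFieldType) (V : vectType F) (x : X F V) :
  label x \in labels X V.
Proof. by rewrite mem_undup; apply/mapP; exists x; rewrite ?mem_enum. Qed.

Lemma labelsP (X : Defs.family) (F : finFieldType) (V : vectType F) m :
  m \in labels X V -> exists x : X F V, label x = m.
Proof. by rewrite mem_undup => /mapP[x _ ->]; exists x. Qed.

Lemma labels_stable (X : Defs.family) (F : finFieldType) (V : vectType F)
    (F' : finFieldType) (V' : vectType F') :
  stable X -> \dim {:V'} = \dim {:V} -> perm_eq (labels X V) (labels X V').
Proof.
move=> stX dimV; apply: uniq_perm; rewrite ?undup_uniq // => m.
apply/idP/idP => /labelsP[x <-].
  by have [x' <-] := stX _ _ x _ V' dimV; exact: mem_labels.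
by have [x' <-] := stX _ _ x _ V (esym dimV); exact: mem_labels.
Qed.

Lemma sum_labels (X : Defs.family) (F : finFieldType) (V : vectType F)
    (A : nmodType) (p : pred (X F V)) (g : X F V -> A) :
  \sum_(m <- labels X V) \sum_(x | p x && (label x == m)) g x = \sum_(x | p x) g x.
Proof.
rewrite (exchange_big_dep p) /=; last by move=> m x _ /andP[].
apply: eq_bigr => x px; rewrite -big_filter (_ : [seq _ <- _ | _] = [:: label x]).
  by rewrite big_seq1.
rewrite (eq_filter (a2 := pred1 (label x))) => [|m]; last by rewrite px /= eq_sym.
by rewrite filter_pred1_uniq ?undup_uniq ?mem_labels.
Qed.

Definition stratified (X : Defs.family) (F : finFieldType) (V : vectType F) (f : functions R X V) :=
  forall x y : X F V, label x = label y -> f x = f y.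

Lemma value_onE (X : Defs.family) (F : finFieldType) (V : vectType F) (f : functions R X V) x :
  stratified f -> value_on f (label x) = f x.
Proof.
move=> stf; rewrite /value_on; case: pickP => [y /eqP|/(_ x)]; first exact: stf.
by rewrite eqxx.
Qed.

Lemma value_on_linear (X : Defs.family) (F : finFieldType) (V : vectType F) m :
  linear (fun f : functions R X V => value_on f m : (Cq R)^o).
Proof.
move=> a f g; rewrite /value_on; case: pickP => [x _|_]; first by rewrite !ffunE.
by rewrite scaler0 addr0.
Qed.

Lemma gsum_linear (X Y : Defs.family) (Z : relation_on X Y) (F : finFieldType) (V : vectType F) x :
  linear (fun f : functions R Y V => gsum Z f x : (Cq R)^o).
Proof.
move=> a f g; rewrite /gsum scaler_sumr -big_split; apply: eq_bigr => m _ /=.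
by rewrite (value_on_linear m a f g) mulrDl; congr (_ + _); exact: (esym (mulrA _ _ _)).
Qed.

Lemma gsum_label (X Y : Defs.family) (Z : relation_on X Y) (F : finFieldType) (V : vectType F)
    (f : functions R Y V) (x x' : X F V) :
  label x = label x' -> gsum Z f x = gsum Z f x'.
Proof. by move=> xx'; rewrite /gsum xx'. Qed.

Section Counted.
Variables (X Y : Defs.family) (Z : relation_on X Y).
Variables (F : finFieldType) (V : vectType F).
Variable P : label_type X -> label_type Y -> {poly nat}.
Hypotheses (stX : stable X) (countZ : counted Z (\dim {:V}) P).
Implicit Types (f : functions R Y V) (x : X F V).

Lemma gsumE f x :
  gsum Z f x = \sum_(m <- labels Y V) value_on f m * at_q2 R (P (label x) m).
Proof.
apply: eq_bigr => m _; congr (_ * _); apply: chi_eq.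
  by move=> F' n [V' [x' [dimV' xx' ->]]]; rewrite countZ ?xx'.
move=> N; have [F' [V' [ltN dimV']]] := large_field N (\dim {:V}).
have [x' xx'] := stX x dimV'; exists F', #|[set y : Y F' V' | Z x' y & label y == m]|
; split=> //; exists V', x'; split=> //.
Qed.

(** A polynomial over [nat] with a zero at one positive integer is 0, so emptiness over the single
    field at hand settles the generic count. *)
Lemma counted_eq0 x m : (forall y, Z x y -> label y != m) -> P (label x) m = 0.
Proof.
move=> xm; apply: (@natpoly_eq0 _ #|F|); first by rewrite ltnW // finNzRing_gt1.
rewrite -countZ //; apply/eqP; rewrite cards_eq0; apply/eqP/setP => y.
by rewrite !inE; apply/andP => -[/xm/negPf->].
Qed.

(** A label on which [c] differs from [cx] carries no point related to [x], so its count vanishes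
    and its coefficient is irrelevant. Both the powers of [q] in the action and the indicator of
    [Y_b] are moved through sums in this way. *)
Lemma gsum_scale f x (c : label_type Y -> Cq R) cx :
  (forall y, Z x y -> c (label y) = cx) ->
  gsum Z [ffun y => c (label y) * f y] x = cx * gsum Z f x.
Proof.
move=> cZ; rewrite !gsumE mulr_sumr; apply: eq_bigr => m _; rewrite mulrA.
have -> : value_on [ffun y => c (label y) * f y] m = c m * value_on f m.
  by rewrite /value_on; case: pickP => [y /eqP <-|_]; rewrite ?ffunE ?mulr0.
have [->//|neq_c] := eqVneq (c m) cx.
rewrite counted_eq0 ?at_q2_0 ?mulr0 // => y /cZ cy.
by apply: contraNneq neq_c => <-; rewrite cy.
Qed.

End Counted.

(** Each iterated sum is a combination of the values of [f] with polynomial coefficients. Over any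
    field these coefficients count paths from a point to a stratum of [W], so equal numbers of
    intermediate points over all fields force equal polynomials. *)
Lemma gsum_comp (X Y Y' W : Defs.family)
    (Z1 : relation_on X Y) (Z2 : relation_on Y W)
    (Z1' : relation_on X Y') (Z2' : relation_on Y' W)
    (F : finFieldType) (V : vectType F) P1 P2 P1' P2'
    (f : functions R W V) (x : X F V) :
  stable X -> stable Y -> stable Y' ->
  counted Z1 (\dim {:V}) P1 -> counted Z2 (\dim {:V}) P2 ->
  counted Z1' (\dim {:V}) P1' -> counted Z2' (\dim {:V}) P2' ->
  (forall (F' : finFieldType) (V' : vectType F') (x' : X F' V') (w : W F' V'),
     #|[set y | Z1 F' V' x' y & Z2 F' V' y w]| =
     #|[set y | Z1' F' V' x' y & Z2' F' V' y w]|) ->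
  gsum Z1 [ffun y => gsum Z2 f y] x = gsum Z1' [ffun y => gsum Z2' f y] x.
Proof.
move=> stX stY stY' count1 count2 count1' count2' count_eq.
have expand (U : Defs.family) (Y1 : relation_on X U) (Y2 : relation_on U W) Q1 Q2 :
    stable U -> counted Y1 (\dim {:V}) Q1 -> counted Y2 (\dim {:V}) Q2 ->
    gsum Y1 [ffun y => gsum Y2 f y] x =
    \sum_(m <- labels W V) value_on f m *
      at_q2 R (\sum_(l <- labels U V) Q1 (label x) l * Q2 l m).
  move=> stU countY1 countY2; rewrite (gsumE stX countY1).
  transitivity (\sum_(l <- labels U V) \sum_(m <- labels W V)
      value_on f m * (at_q2 R (Q1 (label x) l) * at_q2 R (Q2 l m))).
    (* The inner sum depends on its point only through the label, so its value on a stratum can be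
       computed at any point there. *)
    apply: eq_big_seq => l /labelsP[y yl]; rewrite -yl value_onE; last first.
      by move=> y1 y2 /(gsum_label Y2 f); rewrite !ffunE.
    rewrite ffunE (gsumE stU countY2) mulr_suml; apply: eq_bigr => m _.
    by rewrite -mulrA [at_q2 _ _ * _]mulrC.
  rewrite exchange_big; apply: eq_bigr => m _; rewrite at_q2_sum mulr_sumr.
  by apply: eq_bigr => l _; rewrite at_q2M.
rewrite (expand _ _ _ _ _ stY count1 count2) (expand _ _ _ _ _ stY' count1' count2').
apply: eq_bigr => m _; congr (_ * at_q2 R _).
apply: natpoly_eq_unbounded => N.
have [F' [V' [ltN dimV']]] := large_field N (\dim {:V}).
have [x' xx'] := stX _ _ x _ _ dimV'; exists #|F'| => //.
(* At [#|F'|] the coefficient of [m] becomes the number of paths from [x'] through [U] to the points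
   labelled [m]. *)
have eval (U : Defs.family) (Y1 : relation_on X U) (Y2 : relation_on U W) Q1 Q2 :
    stable U -> counted Y1 (\dim {:V}) Q1 -> counted Y2 (\dim {:V}) Q2 ->
    (\sum_(l <- labels U V) Q1 (label x) l * Q2 l m).[#|F'|] =
    (\sum_(w : W F' V' | label w == m) #|[set y | Y1 F' V' x' y & Y2 F' V' y w]|)%N.
  move=> stU countY1 countY2.
  rewrite (big_morph (fun P : {poly nat} => P.[#|F'|]) (id1 := 0)
    (fun P Q => hornerD P Q #|F'|) (horner0 _)).
  rewrite (perm_big _ (labels_stable stU dimV')) /=.
  transitivity (\sum_(l <- labels U V') \sum_(y | Y1 F' V' x' y && (label y == l))
     #|[set w | Y2 F' V' y w & label w == m]|)%N.
    apply: eq_bigr => l _; rewrite hornerM -xx' -countY1 // -[LHS]sum_nat_const.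
    apply: eq_big => y; first by rewrite inE.
    by rewrite inE => /andP[_ /eqP <-]; rewrite countY2.
  rewrite [LHS]sum_labels.
  transitivity (\sum_(y | Y1 F' V' x' y) \sum_(w : W F' V' | Y2 F' V' y w && (label w == m)) 1)%N.
    by apply: eq_bigr => y _; rewrite -sum1_card; apply: eq_bigl => w; rewrite inE.
  rewrite (exchange_big_dep (fun w : W F' V' => label w == m)) /=; last first.
    by move=> y w _ /andP[].
  apply: eq_bigr => w wm; rewrite sum1_card; apply: eq_card => y.
  by rewrite inE -!topredE /= wm andbT.
rewrite (eval _ _ _ _ _ stY count1 count2) (eval _ _ _ _ _ stY' count1' count2').
by apply: eq_bigr => w _; exact: count_eq.
Qed.

End GenericSums.

(** * Counting points of the varieties *)

Lemma gauss_gt n k : (n < k)%N -> gauss n k = 0.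
Proof.
elim: n k => [|n IHn] [|k] //= ltnk.
by rewrite !IHn ?mulr0 ?addr0 // ltnW.
Qed.

(** Hyperplanes are as numerous as lines; this form serves the downward moves of [W]. *)
Lemma gauss_pred n : gauss n.+1 n = \sum_(i < n.+1) 'X^i.
Proof.
have gauss_diag m : gauss m m = 1.
  by elim: m => //= m ->; rewrite gauss_gt // mulr0 addr0.
elim: n => [|n IHn]; first by rewrite big_ord1 expr0.
by rewrite big_ord_recr /= -IHn /= gauss_diag gauss_gt // mulr0 addr0 mulr1.
Qed.

Section PointsM.
Variables (F : finFieldType) (D : vectType F).
Implicit Types x y : M_points D.

Definition M_point (W : {vspace D}) (t : 'End(D)) (inWt : in_M (W, t)) : M_points D :=
  exist (fun u : {vspace D} * 'End(D) => in_M u) (W, t) inWt.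

Lemma spW_M_point W t (inWt : in_M (W, t)) : spW (M_point inWt) = W.
Proof. by []. Qed.

Lemma endt_M_point W t (inWt : in_M (W, t)) : endt (M_point inWt) = t.
Proof. by []. Qed.

Lemma limg_spW x : (limg (endt x) <= spW x)%VS.
Proof. by have /andP[] := valP x. Qed.

Lemma spW_lker x : (spW x <= lker (endt x))%VS.
Proof. by have /andP[] := valP x. Qed.

Lemma dim_lker (t : 'End(D)) : \dim (lker t) = (\dim {:D} - \dim (limg t))%N.
Proof. by have := limg_ker_dim t fullv; rewrite capfv => <-; rewrite addnK. Qed.

Lemma M_label_bounds x :
  ((M_label x).2 <= (M_label x).1)%N /\ ((M_label x).1 + (M_label x).2 <= \dim {:D})%N.
Proof.
split; first exact/dimvS/limg_spW.
have /= := dimvS (spW_lker x); rewrite dim_lker.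
have := dimvS (subvf (limg (endt x))); rewrite /M_label /=; lia.
Qed.

Lemma M_ext x y : spW x = spW y -> endt x = endt y -> x = y.
Proof.
by case: x y => [[W t] inx] [[W' t'] iny] /= eqW eqt; apply: val_inj => /=; congr pair.
Qed.

(** Take a basis, let [t] send its last [r] vectors to the first [r] and kill the others, and let
    [W] be spanned by the first [w]. Then [W] lies in the kernel because [w] is at most [d - r]. *)
Lemma M_exists w r : (r <= w)%N -> (w + r <= \dim {:D})%N ->
  exists x : M_points D, M_label x = (w, r).
Proof.
move=> le_rw le_wrd; set d := \dim {:D} in le_wrd.
have [X [freeX spanX sizeX]] : exists X : seq D, [/\ free X, <<X>>%VS = fullv & size X = d].
  exists (vbasis {:D}); split; last by rewrite size_tuple.
    exact: basis_free (vbasisP _).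
  exact: span_basis (vbasisP _).
have dim_take m : (m <= d)%N -> \dim <<take m X>> = m.
  move=> le_md; have : free (take m X).
    by apply: (@catl_free _ _ (drop m X)); rewrite cat_take_drop.
  by rewrite /free size_takel ?sizeX // => /eqP.
have [f /(_ freeX) fX] := linear_of_free X (nseq (d - r) 0 ++ take r X).
have {}fX : map f X = nseq (d - r) 0 ++ take r X.
  by apply: fX; rewrite size_cat size_nseq size_takel sizeX; lia.
pose t : 'End(D) := linfun f.
have tX : map t X = nseq (d - r) 0 ++ take r X by rewrite -fX; apply: eq_map => v; rewrite lfunE.
have limg_t : limg t = <<take r X>>%VS.
  rewrite -spanX limg_span tX; apply/eqP; rewrite eqEsubv; apply/andP; split.
    apply/span_subvP => v; rewrite mem_cat => /orP[|/memv_span //].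
    by rewrite mem_nseq => /andP[_ /eqP ->]; exact: mem0v.
  by apply: sub_span => v vX; rewrite mem_cat vX orbT.
have W_ker : (<<take w X>> <= lker t)%VS.
  apply/span_subvP => v vX; rewrite memv_ker.
  have : t v \in take w (map t X) by rewrite -map_take map_f.
  rewrite tX take_cat size_nseq; case: ltnP => [_|le_w].
    by move/mem_take; rewrite mem_nseq => /andP[].
  rewrite (_ : (w - (d - r) = 0)%N) ?take0 ?cats0; last by lia.
  by rewrite mem_nseq => /andP[].
have in_Wt : in_M (<<take w X>>%VS, t).
  rewrite /in_M /= W_ker andbT limg_t; apply: sub_span => v.
  by rewrite -(subnKC le_rw) takeD mem_cat => ->.
exists (M_point in_Wt); rewrite /M_label /spW /endt /= limg_t !dim_take //; lia.
Qed.

End PointsM.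

Lemma stable_M : stable M_family.
Proof.
move=> F V x F' V' dimV'; have [le_rw le_wrd] := M_label_bounds x.
rewrite -dimV' in le_wrd; have [x' xx'] := M_exists le_rw le_wrd.
by exists x'; rewrite /= xx' -surjective_pairing.
Qed.

(** The sum of powers counts the lines of [ker t / W]; the one in [M_down_poly] counts the
    hyperplanes of [W / im t]. *)
Definition M_up_poly (d : nat) (l m : nat * nat) : {poly nat} :=
  if m == (l.1.+1, l.2) then \sum_(i < d - l.2 - l.1) 'X^i else 0.

Definition M_down_poly (l m : nat * nat) : {poly nat} :=
  if (m.1.+1, m.2) == l then \sum_(i < l.1 - l.2) 'X^i else 0.

Lemma counted_M_up d : @counted M_family M_family M_up d (M_up_poly d).
Proof.
move=> F V x [w' r'] dimV; rewrite /M_up_poly; case: eqP => [[-> ->]|neq]; last first.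
  rewrite horner0; apply/eqP; rewrite cards_eq0; apply/eqP/setP => y.
  rewrite !inE; apply/andP => -[/and3P[/eqP yt _ /eqP dimy] /eqP [w'E r'E]].
  by case: neq; rewrite -w'E -r'E dimy /= yt.
rewrite -gauss1 /= -dimV -dim_lker.
have := card_extensions 1 (subvv (spW x)) (spW_lker x).
rewrite subnn mul0n expn0 mul1n => <-.
rewrite -(card_in_imset (f := @spW F V)); last first.
  move=> y z; rewrite !inE => /andP[/and3P[/eqP yt _ _] _] /andP[/and3P[/eqP zt _ _] _] yz.
  by apply: M_ext => //; rewrite yt zt.
apply: eq_card => U; apply/imsetP/idP => [[y]|].
  rewrite !inE => /andP[/and3P[/eqP yt xy /eqP dimy] _] ->.
  by rewrite -yt spW_lker dimy (capv_idPr xy) eqxx addn1 /=.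
rewrite inE => /and3P[Uker /eqP/capv_idPr xU /eqP dimU].
have inU : in_M (U, endt x).
  by rewrite /in_M /= Uker (subv_trans (limg_spW x)).
exists (M_point inU) => //; rewrite !inE /M_up /= /M_label spW_M_point endt_M_point.
by rewrite !eqxx xU dimU addn1 !eqxx.
Qed.

Lemma counted_M_down d : @counted M_family M_family M_down d M_down_poly.
Proof.
move=> F V x [w' r'] dimV; rewrite /M_down_poly /=; case: eqP => [lab|neq]; last first.
  rewrite horner0; apply/eqP; rewrite cards_eq0; apply/eqP/setP => y.
  rewrite !inE; apply/andP => -[/and3P[/eqP yt _ /eqP dimy] /eqP [w'E r'E]].
  by case: neq; rewrite -w'E -r'E dimy /= yt.
have [le_rw _] := M_label_bounds x; rewrite -lab /= in le_rw *.
have := limg_spW x; case: lab => dimW dimt imW.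
(* If [W] has the dimension of [im t], nothing lies below it and the sum is empty; [gauss_pred]
   covers the remaining case. *)
move: le_rw; rewrite leq_eqVlt ltnS => /predU1P[r'E|le_rw].
  rewrite -dimW -dimt r'E subnn big_ord0 horner0; apply/eqP; rewrite cards_eq0; apply/eqP/setP => y.
  rewrite !inE; apply/andP => -[/and3P[/eqP yt _ /eqP dimy] /eqP [w'E _]].
  by have := dimvS (limg_spW y); rewrite yt w'E -dimt; lia.
rewrite -dimW -dimt subSn // -gauss_pred.
have := card_extensions (w' - r') (subvv (limg (endt x))) imW.
rewrite subnn mul0n expn0 mul1n -dimW -dimt subSn // dimt => <-.
rewrite -(card_in_imset (f := @spW F V)); last first.
  move=> y z; rewrite !inE => /andP[/and3P[/eqP yt _ _] _] /andP[/and3P[/eqP zt _ _] _] yz.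
  by apply: M_ext => //; rewrite yt zt.
apply: eq_card => U; apply/imsetP/idP => [[y]|].
  rewrite !inE => /andP[/and3P[/eqP yt yx _] /eqP[dimy _]] ->.
  by rewrite yx -yt (capv_idPr (limg_spW y)) eqxx dimy yt -dimt subnKC //=.
rewrite inE => /and3P[UW /eqP/capv_idPr xU /eqP dimU].
have inU : in_M (U, endt x).
  by rewrite /in_M /= xU (subv_trans UW (spW_lker x)).
exists (M_point inU) => //; rewrite !inE /M_down /= /M_label spW_M_point endt_M_point.
by rewrite UW dimU -dimt subnKC // -dimW !eqxx.
Qed.

(** [Inv] makes the number of continuations of a path depend only on its length. *)
Lemma card_paths (T : finType) (k : nat) (R : nat -> T -> T -> bool)
    (Inv : nat -> T -> Prop) (N : nat -> nat) (t0 : T) :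
  Inv 0%N t0 ->
  (forall i x, (i < k)%N -> Inv i x -> #|[set y | R i x y]| = N i) ->
  (forall i x y, (i < k)%N -> Inv i x -> R i x y -> Inv i.+1 y) ->
  #|[set g : {ffun 'I_k.+1 -> T} | (g ord0 == t0) &&
      [forall i : 'I_k, R i (g (widen_ord (leqnSn k) i)) (g (lift ord0 i))]]| =
  (\prod_(i < k) N i)%N.
Proof.
elim: k R Inv N t0 => [|k IHk] R Inv N t0 Inv0 cardR stepR.
  rewrite big_ord0 (_ : [set _ | _] = [set [ffun=> t0]]) ?cards1 //.
  apply/setP => g; rewrite !inE; apply/andP/eqP => [[/eqP g0 _]|->].
    by apply/ffunP => i; rewrite (ord1 i) ffunE.
  by rewrite ffunE; split=> //; apply/forallP => -[].
rewrite big_ord_recl -(cardR 0%N t0) // -sum_nat_const.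
pose tail (g : {ffun 'I_k.+2 -> T}) : {ffun 'I_k.+1 -> T} := [ffun i => g (lift ord0 i)].
pose head (g : {ffun 'I_k.+1 -> T}) := g ord0.
(* All paths start at [t0], so a path is determined by its tail; the tails are then grouped by their
   first vertex. *)
rewrite -(card_in_imset (f := tail)); last first.
  move=> g h; rewrite !inE => /andP[/eqP g0 _] /andP[/eqP h0 _] /ffunP gh.
  apply/ffunP => i; case: (unliftP ord0 i) => [j ->|->]; last by rewrite g0 h0.
  by have := gh j; rewrite !ffunE.
rewrite -sum1_card (partition_big head (mem [set y | R 0%N t0 y])) /=; last first.
  move=> h /imsetP[g]; rewrite !inE => /andP[/eqP g0 /forallP Rg] ->.
  have := Rg ord0; rewrite /head ffunE /= -g0.
  by congr (R 0%N (g _) (g _)); apply: val_inj.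
apply: eq_bigr => y; rewrite inE => R0y.
rewrite -(IHk (fun i => R i.+1) (fun i => Inv i.+1) (fun i => N i.+1) y).
- rewrite sum1_card; apply: eq_card => h; rewrite !inE unfold_in; apply/andP/andP.
    move=> [/imsetP[g]]; rewrite !inE => /andP[_ /forallP Rg] -> ->; split=> //.
    apply/forallP => i; have := Rg (lift ord0 i); rewrite !ffunE.
    by congr (R _ (g _) (g _)); apply: val_inj.
  move=> [/eqP h0 /forallP Rh]; rewrite /head h0 eqxx; split=> //.
  pose g : {ffun 'I_k.+2 -> T} := [ffun i => if unlift ord0 i is Some j then h j else t0].
  have gS (j : 'I_k.+1) : g (lift ord0 j) = h j by rewrite ffunE liftK.
  have g0 : g ord0 = t0 by rewrite ffunE unlift_none.
  apply/imsetP; exists g; last by apply/ffunP => j; rewrite [RHS]ffunE gS.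
  rewrite inE g0 eqxx /=; apply/forallP => i; rewrite gS.
  case: (unliftP ord0 i) => [j ->|->].
    rewrite (_ : widen_ord _ _ = lift ord0 (widen_ord (leqnSn k) j)) ?gS; last exact: val_inj.
    exact: Rh.
  by rewrite (_ : widen_ord _ _ = ord0) ?g0 ?h0 //; apply: val_inj.
- exact: stepR R0y.
- by move=> i x lti; exact: cardR.
by move=> i x z lti; exact: stepR.
Qed.

(** * Flags *)

Section Flags.
Variables (k : nat) (dd : {ffun 'I_k -> nat}).

(** Partial sums turn the subquotient dimensions [alpha] into dimensions of intersections with the
    members of the flag, the data taken by [chain_poly]. *)
Definition psum (a : {ffun 'I_k -> nat}) (i : nat) : nat := (\sum_(j < k | (j < i)%N) a j)%N.

Lemma psum0 a : psum a 0 = 0%N.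
Proof. by rewrite /psum big_pred0. Qed.

Lemma psumS a (i : 'I_k) : psum a i.+1 = (psum a i + a i)%N.
Proof.
rewrite /psum (bigD1 i) //= addnC; congr (_ + _)%N; apply: eq_bigl => j.
by rewrite ltnS -val_eqE /= andbC; case: ltngtP.
Qed.

Lemma psum_full a : psum a k = (\sum_(i < k) a i)%N.
Proof. by apply: eq_bigl => i; rewrite ltn_ord. Qed.

Lemma psum_inj a b : (forall i : 'I_k.+1, psum a i = psum b i) -> a = b.
Proof.
move=> ab; apply/ffunP => i; apply/eqP; rewrite -(eqn_add2l (psum a i)) -psumS.
have := ab (widen_ord (leqnSn k) i); rewrite /= => ->.
by have := ab (lift ord0 i); rewrite /= /bump add1n -psumS => ->.
Qed.

Section Subspaces.
Variables (F : finFieldType) (D : vectType F).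
Implicit Types (DD : flag k D) (X : {vspace D}).

Lemma flag_step DD i : is_flag dd DD -> (step_lo DD i <= step_hi DD i)%VS.
Proof. by case/and3P=> _ _ /forallP/(_ i)/andP[]. Qed.

Lemma dim_cap_flag DD X (i : 'I_k.+1) : is_flag dd DD ->
  \dim (X :&: DD i) = psum (alpha X DD) i.
Proof.
move=> flagD; case: i => i; elim: i => [|i IHi] lti.
  rewrite psum0 (_ : Ordinal lti = ord0); last exact: val_inj.
  by case/and3P: flagD => /eqP -> _ _; rewrite capv0 dimv0.
have ltik : (i < k)%N by rewrite -ltnS.
rewrite -[i.+1 in RHS]/((Ordinal ltik : nat).+1) psumS /= -(IHi (ltnW lti)) ffunE.
rewrite /step_lo /step_hi (_ : widen_ord _ _ = Ordinal (ltnW lti)); last exact: val_inj.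
rewrite (_ : lift _ _ = Ordinal lti); last by apply: val_inj; rewrite /= /bump add1n.
rewrite subnKC // dimvS // capvS // (_ : Ordinal _ = widen_ord (leqnSn k) (Ordinal ltik)).
  rewrite (_ : Ordinal lti = lift ord0 (Ordinal ltik)); last first.
    by apply: val_inj; rewrite /= /bump add1n.
  exact: flag_step.
exact: val_inj.
Qed.

Lemma dim_flag DD (i : 'I_k.+1) : is_flag dd DD -> \dim (DD i) = psum dd i.
Proof.
move=> flagD; rewrite -[DD i]capfv dim_cap_flag //; congr (psum _ i).
apply/ffunP => j; rewrite ffunE !capfv; case/and3P: flagD => _ _ /forallP/(_ j).
by case/andP=> _ /eqP ->; rewrite addKn.
Qed.

Lemma alphaP DD X a : is_flag dd DD ->
  reflect (forall i : 'I_k.+1, \dim (X :&: DD i) = psum a i) (alpha X DD == a).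
Proof.
move=> flagD; apply: (iffP eqP) => [<- i|dimX]; first exact: dim_cap_flag.
by apply: psum_inj => i; rewrite -dimX dim_cap_flag.
Qed.

Lemma flag_full DD : is_flag dd DD -> DD ord_max = fullv.
Proof. by case/and3P=> _ /eqP. Qed.

Lemma dim_alpha DD X : is_flag dd DD -> \dim X = psum (alpha X DD) k.
Proof. by move=> flagD; rewrite -[RHS](dim_cap_flag X ord_max flagD) flag_full // capvf. Qed.

Lemma flag_dim_sum DD : is_flag dd DD -> \dim {:D} = (\sum_(i < k) dd i)%N.
Proof. by move=> flagD; rewrite -psum_full -(flag_full flagD) dim_flag. Qed.

End Subspaces.

Section PointsT.
Variables (F : finFieldType) (D : vectType F).
Implicit Types x y : T_points dd D.

Lemma T_flagP x : is_flag dd (T_flag x).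
Proof. by have /andP[] := valP x. Qed.

Lemma T_ext x y : T_flag x = T_flag y -> T_proj x = T_proj y -> x = y.
Proof.
case: x y => [[DD u] inx] [[DD' u'] iny] eqD equ.
by apply: val_inj; rewrite /= -[DD]/(T_flag (exist _ (DD, u) inx)) eqD; congr pair.
Qed.

Lemma in_T_endt DD (u v : M_points D) : endt v = endt u -> in_T dd (DD, u) -> in_T dd (DD, v).
Proof. by rewrite /in_T /= => ->. Qed.

Definition T_point (DD : flag k D) (u : M_points D) (inDu : in_T dd (DD, u)) : T_points dd D :=
  exist (fun z : flag k D * M_points D => in_T dd z) (DD, u) inDu.

Lemma T_flag_point DD u (inDu : in_T dd (DD, u)) : T_flag (T_point inDu) = DD.
Proof. by []. Qed.

Lemma T_proj_point DD u (inDu : in_T dd (DD, u)) : T_proj (T_point inDu) = u.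
Proof. by []. Qed.

End PointsT.

End Flags.

Lemma eq_chain_poly c c' b b' y y' m :
  (forall i, (i <= m)%N -> [/\ c i = c' i, b i = b' i & y i = y' i]) ->
  chain_poly c b y m = chain_poly c' b' y' m.
Proof.
move=> eq_cby; apply: eq_bigr => i _.
have [-> -> ->] := eq_cby i (ltnW (ltn_ord i)).
by have [-> -> ->] := eq_cby i.+1 (ltn_ord i).
Qed.

(** * Point counts for triples and for the fibres over [M(d)] *)

Section CountT.
Variables (k : nat) (dd : {ffun 'I_k -> nat}).

(** The flag cuts out a chain in [X], and a subspace of [X] has the same intersections with this
    chain as with the flag. *)
Lemma card_between_flag (F : finFieldType) (D : vectType F) (DD : flag k D)
    (B X : {vspace D}) a :
  is_flag dd DD -> (B <= X)%VS ->
  #|[set U : {vspace D} | [&& (B <= U)%VS, (U <= X)%VS & alpha U DD == a]]| =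
  (chain_poly (psum (alpha X DD)) (psum (alpha B DD)) (psum a) k).[#|F|].
Proof.
move=> flagD BX; pose C i := (X :&: DD (inord i))%VS.
have Ck : C k = X.
  by rewrite /C (_ : inord k = ord_max) ?(flag_full flagD) ?capvf //;
    apply: val_inj; rewrite /= inordK.
have C0 : C 0 = 0%VS.
  have /and3P[/eqP D0 _ _] := flagD.
  by rewrite /C (_ : inord 0 = ord0) ?D0 ?capv0 //; apply: val_inj; rewrite /= inordK.
have inC (Y : {vspace D}) i : (Y <= X)%VS -> (Y :&: C i = Y :&: DD (inord i))%VS.
  by move=> YX; rewrite /C capvA (capv_idPl YX).
rewrite (eq_chain_poly (c' := fun i => \dim (C i)) (b' := fun i => \dim (B :&: C i))
  (y' := psum a)); last first.
  move=> i lei; split=> //; last by rewrite inC // (dim_cap_flag _ _ flagD) inordK.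
  by rewrite (dim_cap_flag _ _ flagD) inordK.
rewrite -card_chain_spaces ?psum0 //.
  apply: eq_card => U; rewrite !inE Ck (capv_idPl BX).
  case: (B <= U)%VS => //=; case UX: (U <= X)%VS => //=.
  apply/(alphaP _ _ flagD)/forallP => [dimU i|dimU i].
    by rewrite inC // dimU inordK.
  by have := dimU i; rewrite inC // inord_val => /eqP.
move=> i lti; apply: capvS; first exact: subvv.
rewrite (_ : inord i = widen_ord (leqnSn k) (Ordinal lti)); last first.
  by apply: val_inj; rewrite /= inordK // ltnS ltnW.
rewrite (_ : inord i.+1 = lift ord0 (Ordinal lti)); last first.
  by apply: val_inj; rewrite /= /bump add1n inordK.
exact: (flag_step _ flagD).
Qed.

Let label_T := label_type (T_family dd).

(** With the flag and [t] fixed, the new subspace lies between [W] and [ker t], or between [im t]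
    and [W] for [T_down_poly]; these bounds supply the first two arguments of [chain_poly]. *)
Definition T_up_poly (m m' : label_T) : {poly nat} :=
  if [&& psum m'.1.1 k == (psum m.1.1 k).+1, m'.1.2 == m.1.2 & m'.2 == m.2]
  then chain_poly (psum m.2) (psum m.1.1) (psum m'.1.1) k else 0.

Definition T_down_poly (m m' : label_T) : {poly nat} :=
  if [&& (psum m'.1.1 k).+1 == psum m.1.1 k, m'.1.2 == m.1.2 & m'.2 == m.2]
  then chain_poly (psum m.1.1) (psum m.1.2) (psum m'.1.1) k else 0.

Lemma counted_T_up d : @counted (T_family dd) (T_family dd) (@T_up k dd) d T_up_poly.
Proof.
move=> F V x [[w' r'] n'] _; have flagx := T_flagP x.
rewrite /T_up_poly /=; case: ifP => [/and3P[/eqP dimw' /eqP r'E /eqP n'E]|neq]; last first.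
  rewrite horner0; apply/eqP; rewrite cards_eq0; apply/eqP/setP => y.
  rewrite !inE; apply/andP => -[/andP[/eqP yD /and3P[/eqP yt _ /eqP dimy]] /eqP[w'E r'E n'E]].
  move/and3P: neq; case; rewrite -w'E -r'E -n'E /alpha_ker yD yt; split=> //.
  by rewrite -!(dim_alpha _ flagx) dimy.
have lex := spW_lker (T_proj x).
rewrite -(card_between_flag _ flagx lex).
rewrite -(card_in_imset (f := fun y : T_points dd V => spW (T_proj y))); last first.
  move=> y z; rewrite !inE => /andP[/andP[/eqP yD /and3P[/eqP yt _ _]] _].
  move=> /andP[/andP[/eqP zD /and3P[/eqP zt _ _]] _] yz.
  apply: T_ext; first by rewrite yD zD.
  by apply: M_ext => //; rewrite yt zt.
apply: eq_card => U; apply/imsetP/idP => [[y]|].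
  rewrite !inE => /andP[/andP[/eqP yD /and3P[/eqP yt xy _]] /eqP[w'E _ _]] ->.
  by rewrite xy -yt spW_lker -yD w'E eqxx.
rewrite inE => /and3P[xU Uker /eqP Ua].
have inU : in_M (U, endt (T_proj x)).
  by rewrite /in_M /= Uker (subv_trans (limg_spW (T_proj x))).
have inDU : in_T dd (T_flag x, M_point inU).
  apply: (@in_T_endt _ _ _ _ _ (T_proj x)) => //.
  by have := valP x; rewrite /T_flag /T_proj; case: (val x).
exists (T_point inDU) => //.
rewrite !inE /T_up /= /T_label /alpha_ker /M_up T_flag_point T_proj_point.
rewrite spW_M_point endt_M_point !eqxx xU Ua /= r'E n'E !eqxx andbT.
by rewrite (dim_alpha U flagx) (dim_alpha (spW _) flagx) Ua dimw'.
Qed.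

Lemma counted_T_down d : @counted (T_family dd) (T_family dd) (@T_down k dd) d T_down_poly.
Proof.
move=> F V x [[w' r'] n'] _; have flagx := T_flagP x.
rewrite /T_down_poly /=; case: ifP => [/and3P[/eqP dimw' /eqP r'E /eqP n'E]|neq]; last first.
  rewrite horner0; apply/eqP; rewrite cards_eq0; apply/eqP/setP => y.
  rewrite !inE; apply/andP => -[/andP[/eqP yD /and3P[/eqP yt _ /eqP dimy]] /eqP[w'E r'E n'E]].
  move/and3P: neq; case; rewrite -w'E -r'E -n'E /alpha_ker yD yt; split=> //.
  by rewrite -!(dim_alpha _ flagx) dimy.
have lex := limg_spW (T_proj x).
rewrite -(card_between_flag _ flagx lex).
rewrite -(card_in_imset (f := fun y : T_points dd V => spW (T_proj y))); last first.
  move=> y z; rewrite !inE => /andP[/andP[/eqP yD /and3P[/eqP yt _ _]] _].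
  move=> /andP[/andP[/eqP zD /and3P[/eqP zt _ _]] _] yz.
  apply: T_ext; first by rewrite yD zD.
  by apply: M_ext => //; rewrite yt zt.
apply: eq_card => U; apply/imsetP/idP => [[y]|].
  rewrite !inE => /andP[/andP[/eqP yD /and3P[/eqP yt yx _]] /eqP[w'E _ _]] ->.
  by rewrite yx -yt limg_spW -yD w'E eqxx.
rewrite inE => /and3P[imU Ux /eqP Ua].
have inU : in_M (U, endt (T_proj x)).
  by rewrite /in_M /= imU (subv_trans Ux (spW_lker (T_proj x))).
have inDU : in_T dd (T_flag x, M_point inU).
  apply: (@in_T_endt _ _ _ _ _ (T_proj x)) => //.
  by have := valP x; rewrite /T_flag /T_proj; case: (val x).
exists (T_point inDU) => //.
rewrite !inE /T_down /= /T_label /alpha_ker /M_down T_flag_point T_proj_point.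
rewrite spW_M_point endt_M_point !eqxx Ux Ua /= r'E n'E !eqxx andbT.
by rewrite (dim_alpha U flagx) (dim_alpha (spW _) flagx) Ua dimw'.
Qed.

Definition fibre (F : finFieldType) (D : vectType F) (x : M_points D) (y : T_points dd D) : bool :=
  T_proj y == x.

(** Factor [i] counts the choices of the next flag member after [D_i], as subspaces positioned along
    the chain [0], [im t], [W], [ker t], [t^-1(D_i)]. The three lists hold the dimensions of this
    chain and of its intersections with [D_i] and [D_(i+1)]. *)
Definition fibre_poly (d : nat) (l : nat * nat) (m : label_T) : {poly nat} :=
  \prod_(i < k)
    chain_poly (nth 0 [:: 0; l.2; l.1; d - l.2; d - l.2 + psum m.1.2 i])%N
      (nth 0 [:: 0; psum m.1.2 i; psum m.1.1 i; psum m.2 i; psum dd i])%N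
      (nth 0 [:: 0; psum m.1.2 i.+1; psum m.1.1 i.+1; psum m.2 i.+1; psum dd i.+1])%N 4.

Lemma dim_lpreim (F : finFieldType) (D : vectType F) (t : 'End(D)) (X : {vspace D}) :
  \dim (t @^-1: X) = (\dim (lker t) + \dim (limg t :&: X))%N.
Proof.
rewrite -(limg_ker_dim t (t @^-1: X)) -lpreim_cap_limg lpreimK ?capvSr //.
rewrite [(X :&: _)%VS]capvC (_ : _ :&: lker t = lker t)%VS //.
by apply/capv_idPr; rewrite -lpreim0 lpreimS // sub0v.
Qed.

Lemma limg_lpreim (F : finFieldType) (D : vectType F) (t : 'End(D)) (X Y : {vspace D}) :
  (t @: Y <= X)%VS = (Y <= t @^-1: X)%VS.
Proof.
apply/subvP/subvP => YX v.
  by move=> vY; rewrite -memv_preim YX // memv_img.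
by case/memv_imgP => u /YX uX ->; rewrite memv_preim.
Qed.

Lemma counted_fibre : @counted M_family (T_family dd) fibre (\sum_(i < k) dd i)%N
  (fibre_poly (\sum_(i < k) dd i)).
Proof.
move=> F V x [[a r] n] dimV; set d := (\sum_(i < k) dd i)%N in dimV *.
pose t := endt x; pose W := spW x.
pose C (X : {vspace V}) := nth fullv [:: 0%VS; limg t; W; lker t; (t @^-1: X)%VS].
pose y i := nth 0%N [:: 0; psum r i.+1; psum a i.+1; psum n i.+1; psum dd i.+1]%N.
pose S i (X Y : {vspace V}) := [&& (X <= Y)%VS, (t @: Y <= X)%VS, \dim Y == psum dd i.+1,
    \dim (limg t :&: Y) == psum r i.+1, \dim (W :&: Y) == psum a i.+1
    & \dim (lker t :&: Y) == psum n i.+1].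
pose Inv i (X : {vspace V}) := [/\ (t @: X <= X)%VS, \dim X = psum dd i,
  \dim (limg t :&: X) = psum r i, \dim (W :&: X) = psum a i & \dim (lker t :&: X) = psum n i].
(* The condition on the image of [Y] bounds [Y] above by the preimage of [X], the top of the
   chain. *)
have SE i X Y : (X <= t @^-1: X)%VS -> S i X Y = (Y \in chain_spaces (C X) X (y i) 4).
  move=> CX4; rewrite /S inE /C /= (capv_idPl CX4) limg_lpreim; congr (_ && _).
  apply/and5P/andP; last first.
    move=> [YX /forallP dimY]; have := (dimY (@Ordinal 5 1 isT), dimY (@Ordinal 5 2 isT),
      dimY (@Ordinal 5 3 isT), dimY (@Ordinal 5 4 isT)).
    by rewrite /= /y /= (capv_idPl YX) ![(_ :&: Y)%VS]capvC => -[[[-> ->] ->] ->].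
  move=> [YX dimY dimr dima dimn]; split=> //; apply/forallP => -[i' lti'].
  case: i' lti' => [|[|[|[|[|//]]]]] lti' /=; rewrite /y /= ?capv0 ?dimv0 // ?(capv_idPl YX) //.
  - by rewrite capvC.
  - by rewrite capvC.
  - by rewrite capvC.
have im_W := limg_spW x; have W_ker := spW_lker x.
(* Points of the fibre are paths of subspaces starting at 0; that the last one is the whole space
   follows from its dimension. *)
transitivity #|[set g : {ffun 'I_k.+1 -> {vspace V}} | (g ord0 == 0%VS) &&
    [forall i : 'I_k, S i (g (widen_ord (leqnSn k) i)) (g (lift ord0 i))]]|.
  rewrite -(card_in_imset (f := fun y : T_points dd V => T_flag y)); last first.
    move=> u v; rewrite !inE => /andP[/eqP ux _] /andP[/eqP vx _] uv.
    by apply: T_ext; rewrite // ux vx.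
  apply: eq_card => g; apply/imsetP/idP => [[u]|].
    rewrite !inE => /andP[/eqP ux /eqP[alphaW alphat alphak] ->].
    have flagu := T_flagP u; have /and3P[-> _ _] := flagu.
    apply/forallP => i; rewrite /S.
    have tu : (t @: step_hi (T_flag u) i <= step_lo (T_flag u) i)%VS.
      by have /andP[_ /forallP/(_ i)] := valP u; rewrite -[(val u).2]/(T_proj u) ux.
    rewrite (flag_step _ flagu) tu (dim_flag _ flagu).
    rewrite !(dim_cap_flag _ _ flagu) -alphaW -alphat -alphak /alpha_ker ux.
    by rewrite !eqxx.
  rewrite inE => /andP[/eqP g0 /forallP gS].
  have gdim (i : 'I_k.+1) : [/\ \dim (g i) = psum dd i, \dim (limg t :&: g i) = psum r i,
      \dim (W :&: g i) = psum a i & \dim (lker t :&: g i) = psum n i].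
    case: (unliftP ord0 i) => [j ->|->]; last by rewrite g0 !capv0 dimv0 !psum0.
    have /and5P[_ _ /eqP-> /eqP-> /andP[/eqP-> /eqP->]] := gS j.
    by rewrite /= /bump add1n.
  have flagg : is_flag dd g.
    rewrite /is_flag g0 eqxx eqEdim subvf dimV; have [-> _ _ _] := gdim ord_max.
    rewrite psum_full leqnn; apply/forallP => i; have /and3P[-> _ _] := gS i.
    have [-> _ _ _] := gdim (lift ord0 i); have [-> _ _ _] := gdim (widen_ord (leqnSn k) i).
    by rewrite /= /bump add1n psumS.
  have inTg : in_T dd (g, x).
    by rewrite /in_T flagg; apply/forallP => i; have /and3P[_ -> _] := gS i.
  exists (T_point inTg) => //; rewrite !inE /fibre /= T_proj_point eqxx.
  rewrite /T_label /alpha_ker T_flag_point T_proj_point !xpair_eqE -andbA /=.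
  by apply/and3P; split; apply/(alphaP _ _ flagg) => i; have [] := gdim i.
rewrite (@card_paths _ k S Inv (fun i => (chain_poly
  (nth 0 [:: 0; \dim (limg t); \dim W; d - \dim (limg t); d - \dim (limg t) + psum r i])%N
  (nth 0 [:: 0; psum r i; psum a i; psum n i; psum dd i])%N (y i) 4).[#|F|])).
- by rewrite horner_prod.
- by rewrite /Inv limg0 subvv !capv0 dimv0 !psum0.
- move=> i X lti [tX dimX dimr dima dimn].
  have CX4 : (X <= t @^-1: X)%VS by rewrite -limg_lpreim.
  rewrite (_ : [set _ | _] = chain_spaces (C X) X (y i) 4); last first.
    by apply/setP => Y; rewrite [LHS]inE SE.
  have subC j : (j < 4)%N -> (C X j <= C X j.+1)%VS.
    case: j => [|[|[|[|//]]]] _; rewrite /C /=; [exact: sub0v | exact: im_W | exact: W_ker |].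
    by rewrite -lpreim0 lpreimS // sub0v.
  rewrite (card_chain_spaces _ (C := C X) (y := y i) erefl erefl subC).
  congr (horner _ _); apply: eq_chain_poly => -[|[|[|[|[|//]]]]] _; rewrite /C /=.
  + by rewrite capv0 dimv0.
  + by rewrite capvC.
  + by rewrite capvC.
  + by rewrite capvC dim_lker dimV.
  + by rewrite (capv_idPl CX4) dim_lpreim dim_lker dimV dimr.
move=> i X Y lti [tX dimX dimr dima dimn].
rewrite /Inv => /and5P[XY tY /eqP-> /eqP-> /andP[/eqP-> /eqP->]].
by split=> //; apply: subv_trans XY.
Qed.

(** The fibre over a point of [M] with the same label over the other field is
    non-empty, as its counting polynomial is non-zero. *)
Lemma stable_T : stable (T_family dd).
Proof.
move=> F V y F' V' dimV'; pose d := (\sum_(i < k) dd i)%N.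
have dimV : \dim {:V} = d by rewrite (flag_dim_sum (T_flagP y)).
have [x' xx'] := stable_M (T_proj y : M_family F V) dimV'.
have count_y := @counted_fibre F V (T_proj y) (label y) dimV.
have count_y' := @counted_fibre F' V' x' (label y) (etrans dimV' dimV).
have P0 : fibre_poly d (label (T_proj y : M_family F V)) (label y) != 0.
  apply/eqP => P0; move: count_y; rewrite P0 horner0 => /eqP.
  by rewrite cards_eq0 => /eqP/setP/(_ y); rewrite !inE /fibre !eqxx.
have [S0|[y']] := set_0Vmem [set y' : T_family dd F' V' | fibre x' y' & label y' == label y].
  move: count_y'; rewrite S0 cards0 xx' => /esym P0'; case/eqP: P0; apply: natpoly_eq0 P0'.
  by rewrite ltnW // finNzRing_gt1.
by rewrite inE => /andP[_ /eqP yy']; exists y'.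
Qed.

End CountT.

(** * Intertwiners *)

(** The powers of [q] in the definition of [E] and [F] make the geometric sums symmetric under
    inversion of [q], hence quantum integers. *)
Lemma sum_qint (K : fieldType) (x : K) N : x != 0 -> x ^+ 2 != 1 ->
  x ^ (- (N%:Z - 1)) * (\sum_(i < N) (x ^+ 2) ^+ i) = qint x N.
Proof.
move=> x0; rewrite -subr_eq0 => x21.
case: N => [|N]; first by rewrite big_ord0 mulr0 qint0.
have -> : \sum_(i < N.+1) (x ^+ 2) ^+ i = ((x ^+ 2) ^+ N.+1 - 1) / (x ^+ 2 - 1).
  by rewrite subrX1 mulrAC divff // mul1r.
have -> : - (N.+1%:Z - 1) = - N%:Z by lia.
rewrite -exprz_inv -[x^-1 ^ N%:Z]/(x^-1 ^+ N) exprVn /qint -!exprM mulnC exprM.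
rewrite !exprS expr0 mulr1 in x21 *.
have := expf_neq0 N x0; move: (x ^+ N) => y y0.
by field; rewrite y0 x21 x0.
Qed.

(** * Function spaces as conditions on values, and explicit operators on [M(d)] *)

Section FunctionSpaces.
Variable R : realType.

Lemma value_on_empty (X : Defs.family) (F : finFieldType) (V : vectType F)
    (f : functions R X V) m :
  (forall x : X F V, label x != m) -> value_on f m = 0.
Proof. by move=> xm; rewrite /value_on; case: pickP => // x; rewrite (negPf (xm x)). Qed.

Lemma stratified_sum (X : Defs.family) (F : finFieldType) (V : vectType F)
    (f : functions R X V) :
  stratified f -> f = \sum_(m <- labels X V) value_on f m *: indic R V m.
Proof.
move=> stf; apply/ffunP => x; rewrite sum_ffunE (bigD1_seq (label x)) ?undup_uniq ?mem_labels //=.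
rewrite big1 => [|m neq_m]; rewrite !ffunE; last by rewrite eq_sym (negPf neq_m) scaler0.
by rewrite eqxx addr0 value_onE // -[RHS]/(f x * 1) mulr1.
Qed.

Lemma strata_spanP (X : Defs.family) (F : finFieldType) (V : vectType F)
    (f : functions R X V) :
  f \in strata_span R X V <-> stratified f.
Proof.
split=> [fX x y xy|stf].
  move: fX; rewrite /strata_span; set s := [seq _ | _ <- _] => fX.
  rewrite (coord_span (X := in_tuple s) fX) !sum_ffunE; apply: eq_bigr => i _.
  rewrite !ffunE; have /mapP[m _ ->] := mem_nth 0 (ltn_ord i : (i < size s)%N).
  by rewrite !ffunE xy.
rewrite (stratified_sum stf) big_seq; apply: memv_suml => m mX.
by apply/memvZ/memv_span/map_f.
Qed.

Section OnM.
Variables (F : finFieldType) (D : vectType F).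
Implicit Types (f : functions R M_family D) (x : M_points D).

Lemma calMrP f r : f \in calMr R D r <->
  stratified f /\ (forall x, \dim (limg (endt x)) != r -> f x = 0).
Proof.
split=> [/memv_sumP[g gr ->]|[stf f0]].
  have gE i x : g i x = value_on (g i) (i : nat, r) * (M_label x == (i : nat, r))%:R.
    have /vlineP[c ->] := gr i isT; rewrite ffunE /value_on; case: pickP => [y /eqP yi|nx].
      by rewrite !ffunE yi eqxx -![c *: _]/(c * _) mulr1.
    by rewrite mul0r !ffunE nx scaler0.
  split=> [x y xy|x xr]; rewrite !sum_ffunE; last first.
    by rewrite big1 // => i _; rewrite gE xpair_eqE (negPf xr) andbF mulr0.
  by apply: eq_bigr => i _; rewrite !gE -[M_label x]/(label (x : M_family F D)) xy.
have -> : f = \sum_(w < (\dim {:D}).+1)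
    value_on f (w : nat, r) *: indic R (X := M_family) D (w : nat, r).
  apply/ffunP => x; rewrite sum_ffunE.
  have ltw : (\dim (spW x) < (\dim {:D}).+1)%N by rewrite ltnS dimvS ?subvf.
  have [xr|xr] := eqVneq (\dim (limg (endt x))) r; last first.
    rewrite f0 // big1 // => i _; rewrite !ffunE /= xpair_eqE (negPf xr) andbF.
    by rewrite scaler0.
  rewrite (bigD1 (Ordinal ltw)) //= big1 => [|i neq_i].
    rewrite addr0 !ffunE /= /M_label -xr eqxx.
    by rewrite -[RHS]/(value_on f (label (x : M_family F D)) * 1) mulr1 value_onE.
  rewrite !ffunE /= xpair_eqE; case: eqP => [wi|]; last by rewrite scaler0.
  by case/eqP: neq_i; apply: val_inj; rewrite /= wi.
by apply: memv_sumr => w _; apply: memvZ; apply: memv_line.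
Qed.

Lemma calMP f : f \in calM R D <-> stratified f.
Proof.
split=> [/memv_sumP[g gr ->] x y xy|stf].
  rewrite !sum_ffunE; apply: eq_bigr => r _.
  by have /calMrP[stg _] := gr r isT; apply: stg.
have -> : f = \sum_(r < (\dim {:D}).+1)
    [ffun x => (\dim (limg (endt x)) == r)%:R * f x].
  apply/ffunP => x; rewrite sum_ffunE.
  have ltr : (\dim (limg (endt x)) < (\dim {:D}).+1)%N by rewrite ltnS dimvS ?subvf.
  rewrite (bigD1 (Ordinal ltr)) //= big1 => [|i neq_i]; rewrite ffunE.
    by rewrite eqxx mul1r addr0.
  case: eqP => [wi|]; last by rewrite mul0r.
  by case/eqP: neq_i; apply: val_inj; rewrite /= wi.
apply: memv_sumr => r _; apply/calMrP; split=> [x y xy|x xr]; rewrite !ffunE.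
  by rewrite (stf x y xy); case: xy => _ ->.
by rewrite (negPf xr) mul0r.
Qed.

Lemma act_M_stratified g f : stratified f -> stratified (act_M g f).
Proof.
move=> stf x y xy; rewrite !ffunE (stf x y xy) (gsum_label _ f xy) (gsum_label _ f xy).
by rewrite !dim_lker; case: xy => -> ->.
Qed.

Lemma gsum_M_up f x : gsum (X := M_family) (Y := M_family) M_up f x =
  value_on f ((\dim (spW x)).+1, \dim (limg (endt x))) *
  at_q2 R (\sum_(i < \dim {:D} - \dim (limg (endt x)) - \dim (spW x)) 'X^i).
Proof.
rewrite (gsumE stable_M (@counted_M_up _)) /M_up_poly /=; set m0 := (_.+1, _).
have [m0D|m0D] := boolP (m0 \in labels M_family D).
  rewrite (bigD1_seq m0) ?undup_uniq //= eqxx [X in _ + X]big1 ?addr0 // => m /negPf ->.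
  by rewrite at_q2_0 mulr0.
rewrite value_on_empty ?mul0r => [|y]; last first.
  by apply: contraNneq m0D => <-; exact: mem_labels.
rewrite big1_seq // => m /= mD; case: eqP => [mm0|]; last by rewrite at_q2_0 mulr0.
by rewrite -mm0 mD in m0D.
Qed.

Lemma gsum_M_down f x : gsum (X := M_family) (Y := M_family) M_down f x =
  value_on f ((\dim (spW x)).-1, \dim (limg (endt x))) *
  at_q2 R (\sum_(i < \dim (spW x) - \dim (limg (endt x))) 'X^i).
Proof.
rewrite (gsumE stable_M (@counted_M_down (\dim {:D}))) /M_down_poly /=; set m0 := (_.-1, _).
(* For [W = 0] the predecessor names the wrong label, but the geometric sum is empty and no label
   lies below. *)
have [w0|w_gt0] := posnP (\dim (spW x)).
  rewrite w0 big_ord0 at_q2_0 mulr0 big1 // => m _; rewrite /M_label w0 xpair_eqE /=.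
  by rewrite at_q2_0 mulr0.
have m0E m : ((m.1.+1, m.2) == M_label x) = (m == m0).
  by case: m => a b; rewrite !xpair_eqE /m0 -{1}(prednK w_gt0) eqSS.
clearbody m0.
have [m0D|m0D] := boolP (m0 \in labels M_family D).
  rewrite (bigD1_seq m0) ?undup_uniq //= m0E eqxx [X in _ + X]big1 ?addr0 // => m /negPf mm0.
  by rewrite m0E mm0 at_q2_0 mulr0.
rewrite value_on_empty ?mul0r => [|y]; last first.
  by apply: contraNneq m0D => <-; exact: mem_labels.
rewrite big1_seq // => m /= mD; rewrite m0E; case: eqP => [mm0|]; last by rewrite at_q2_0 mulr0.
by rewrite -mm0 mD in m0D.
Qed.

End OnM.

Lemma qint_at_q2 N : q ^ (- (N%:Z - 1)) * at_q2 R (\sum_(i < N) 'X^i) = qint (@q R) N.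
Proof.
rewrite -(sum_qint N (q_neq0 R) (@qX_neq1 R 2 isT)).
congr (_ * _).
rewrite at_q2_sum.
apply: eq_bigr => i _.
by rewrite /at_q2 map_polyXn hornerXn.
Qed.

End FunctionSpaces.

(** * Compatibility of the pushforwards with the generators *)

Section Intertwining.
Variables (R : realType) (k : nat) (dd n : {ffun 'I_k -> nat}).
Variables (F : finFieldType) (D : vectType F).
Hypothesis dimD : \dim {:D} = (\sum_(i < k) dd i)%N.
Implicit Types (f : functions R (T_family dd) D) (x : M_points D).

Let label_T := label_type (T_family dd).

Let fibreD : @counted M_family (T_family dd) (@fibre k dd) (\dim {:D})
  (@fibre_poly k dd (\dim {:D})).
Proof. by rewrite dimD; exact: counted_fibre. Qed.

(** The indicator of the set defining [T_map], written as a function of the label so that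
    [gsum_scale] applies. *)
Let on_n (m : label_T) : Cq R := (m.2 == n)%:R.

Let cut f : functions R (T_family dd) D := [ffun y => on_n (label y) * f y].

Lemma T_mapE f x : T_map n f x = gsum (X := M_family) (Y := T_family dd) (@fibre k dd) (cut f) x.
Proof. by rewrite ffunE. Qed.

Lemma T_map_scale (c : label_T -> Cq R) cx f x :
  (forall y : T_points dd D, T_proj y = x -> c (T_label y) = cx) ->
  T_map n [ffun y => c (label (y : T_family dd F D)) * f y] x = cx * T_map n f x.
Proof.
move=> cxE; rewrite !T_mapE -(gsum_scale stable_M fibreD _ (c := c)); last first.
  by move=> y /eqP; exact: cxE.
congr (gsum _ _ _); apply/ffunP => y; rewrite !ffunE; exact: mulrCA.
Qed.

Section MoveW.
Variables (Zm : relation_on M_family M_family) (Pm : nat * nat -> nat * nat -> {poly nat}).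
Variable Pt : label_T -> label_T -> {poly nat}.

(** [T_up] and [T_down] are the instances for [M_up] and [M_down], so [E] and [F] are handled
    together. *)
Definition lift_T (F' : finFieldType) (D' : vectType F') (y z : T_points dd D') : bool :=
  (T_flag z == T_flag y) && Zm (T_proj y) (T_proj z).

Hypotheses (endtZ : forall (F' : finFieldType) (D' : vectType F') (x y : M_points D'),
  Zm x y -> endt y = endt x).
Hypotheses (countM : counted Zm (\dim {:D}) Pm).
Hypotheses (countT : @counted (T_family dd) (T_family dd) lift_T (\dim {:D}) Pt).

(** By [gsum_comp] it suffices to compare intermediate points between [x'] and [z]. When [x'] is
    related to the projection of [z] there is exactly one on each side: the flag of [z] over [x'],
    and the projection of [z]. Otherwise there is none. *)
Lemma T_map_gsum f x :
  T_map n [ffun y => gsum (X := T_family dd) (Y := T_family dd) lift_T f y] x =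
  gsum Zm (T_map n f) x.
Proof.
(* Moving [W] changes neither the flag nor [t], so it preserves [alpha_ker] and commutes with the
   cut. *)
have cut_gsum : cut [ffun y => gsum (X := T_family dd) (Y := T_family dd) lift_T f y] =
    [ffun y => gsum (X := T_family dd) (Y := T_family dd) lift_T (cut f) y].
  apply/ffunP => y; rewrite !ffunE.
  rewrite (gsum_scale (@stable_T _ _) countT _ (c := on_n) (cx := on_n (label y))) //.
  move=> z /andP[/eqP zD /endtZ zt]; rewrite /on_n /= /T_label /= /alpha_ker.
  by rewrite zD zt.
have cut_map : T_map n f =
    [ffun x' => gsum (X := M_family) (Y := T_family dd) (@fibre k dd) (cut f) x'].
  by apply/ffunP => x'; rewrite [RHS]ffunE; exact: T_mapE.
rewrite T_mapE cut_gsum cut_map.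
apply: (gsum_comp _ _ stable_M (@stable_T _ _) stable_M fibreD countT countM fibreD).
move=> F' D' x' z.
have [xz|not_xz] := boolP (Zm x' (T_proj z)); last first.
  rewrite !(eq_card0 (A := mem [set _ | _])) // => y; rewrite !inE.
    by apply/andP => -[xy /eqP zy]; rewrite zy xy in not_xz.
  by apply/andP => -[/eqP yx /andP[_]]; rewrite yx (negPf not_xz).
(* The flag of [z] is admissible over [x'], since admissibility involves only [t]. *)
have inTx : in_T dd (T_flag z, x').
  apply: (@in_T_endt _ _ _ _ _ (T_proj z)); first by rewrite (endtZ xz).
  by have := valP z; rewrite /T_flag /T_proj; case: (val z).
transitivity #|[set T_point inTx]|.
  apply: eq_card => y; rewrite !inE /fibre /lift_T; apply/andP/eqP.
    by move=> [/eqP yx /andP[/eqP zy _]]; apply: T_ext; rewrite ?yx ?zy.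
  by move=> ->; rewrite T_proj_point T_flag_point !eqxx.
rewrite cards1 -(cards1 (T_proj z)); apply: eq_card => y; rewrite !inE /fibre.
by apply/eqP/andP => [->|[_ /eqP]] //; rewrite xz eqxx.
Qed.

End MoveW.

Lemma T_map_E f x :
  T_map n [ffun y => gsum (X := T_family dd) (Y := T_family dd) (@T_up k dd) f y] x =
  gsum (X := M_family) (Y := M_family) M_up (T_map n f) x.
Proof.
apply: (T_map_gsum (Zm := M_up)).
- by move=> F' D' y z /and3P[/eqP].
- exact: counted_M_up.
exact: counted_T_up.
Qed.

Lemma T_map_F f x :
  T_map n [ffun y => gsum (X := T_family dd) (Y := T_family dd) (@T_down k dd) f y] x =
  gsum (X := M_family) (Y := M_family) M_down (T_map n f) x.
Proof.
apply: (T_map_gsum (Zm := M_down)).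
- by move=> F' D' y z /and3P[/eqP].
- exact: counted_M_down.
exact: counted_T_down.
Qed.

Lemma T_label_dims (y : T_points dd D) (m := T_label y) (u := T_proj y) :
  [/\ \dim (spW u) = psum m.1.1 k, \dim (limg (endt u)) = psum m.1.2 k
    & \dim (lker (endt u)) = psum m.2 k].
Proof. by rewrite -!(dim_alpha _ (T_flagP y)). Qed.

(** The action is split into a weight read off the label, which [T_map_scale] carries through, and
    the plain sum [act_sum], which [T_map_gsum] carries through. *)
Definition T_weight (g : generator) (m : label_T) : Cq R :=
  let w := (psum m.1.1 k)%:Z in let r := (psum m.1.2 k)%:Z in
  let l := (psum m.2 k)%:Z in let d := (\dim {:D})%:Z in
  match g with
  | gE => q ^ (- (l - w - 1))
  | gF => q ^ (- (w - r - 1))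
  | gK => q ^ (d - 2 * w)
  | gKinv => q ^ (- (d - 2 * w))
  end.

Definition act_sum (g : generator) f : functions R (T_family dd) D :=
  match g with
  | gE => [ffun y => gsum (X := T_family dd) (Y := T_family dd) (@T_up k dd) f y]
  | gF => [ffun y => gsum (X := T_family dd) (Y := T_family dd) (@T_down k dd) f y]
  | _ => f
  end.

Lemma act_TE g f :
  act_T g f = [ffun y => T_weight g (label (y : T_family dd F D)) * act_sum g f y].
Proof.
apply/ffunP => y; rewrite !ffunE /T_weight; have [-> -> ->] := T_label_dims y.
by case: g; rewrite //= ffunE.
Qed.

Lemma act_T_stratified g f : stratified f -> stratified (act_T g f).
Proof.
move=> stf y z yz; rewrite act_TE !ffunE yz; congr (_ * _).
by case: g; rewrite /act_sum ?ffunE; [exact: gsum_label | exact: gsum_label | exact: stf | exact: stf].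
Qed.

Lemma T_map_act g f : T_map n (act_T g f) = act_M g (T_map n f).
Proof.
apply/ffunP => x; rewrite act_TE.
pose cx : Cq R := let w := (\dim (spW x))%:Z in let r := (\dim (limg (endt x)))%:Z in
  let l := (\dim (lker (endt x)))%:Z in let d := (\dim {:D})%:Z in
  match g with
  | gE => q ^ (- (l - w - 1))
  | gF => q ^ (- (w - r - 1))
  | gK => q ^ (d - 2 * w)
  | gKinv => q ^ (- (d - 2 * w))
  end.
have weightE (y : T_points dd D) : T_proj y = x -> T_weight g (T_label y) = cx.
  by move=> yx; rewrite /T_weight /cx -yx; have [-> -> ->] := T_label_dims y.
rewrite (T_map_scale _ weightE).
rewrite [RHS]ffunE /cx; case: g {cx weightE} => //; congr (_ * _).
  exact: T_map_E.
exact: T_map_F.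
Qed.

Lemma T_map_linear : linear (T_map (R := R) (dd := dd) n (F := F) (D := D)).
Proof.
move=> a f g; have cut_linear : cut (a *: f + g) = a *: cut f + cut g.
  by apply/ffunP => y; rewrite !ffunE mulrDr; congr (_ + _); exact: mulrCA.
apply/ffunP => x; rewrite [RHS]ffunE [X in _ = X + _]ffunE !T_mapE cut_linear.
exact: gsum_linear.
Qed.

Lemma T_map_stratified f : stratified (T_map n f).
Proof. by move=> x y xy; rewrite !T_mapE; exact: gsum_label. Qed.

(** The kernel of [t] is the same along the fibre over [x], whereas [alpha_ker = n] demands
    dimension [psum n k]; the indicator thus vanishes on the fibre. *)
Lemma T_map_eq0 f x : \dim (lker (endt x)) != psum n k -> T_map n f x = 0.
Proof.
move=> ker_x; rewrite T_mapE (gsum_scale stable_M fibreD _ (cx := 0)) ?mul0r // => y /eqP yx.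
have /negPf yn : (T_label y).2 != n.
  apply: contraNneq ker_x => yn; rewrite -yn -yx.
  by have [_ _ ->] := T_label_dims y.
by rewrite /on_n -[label _]/(T_label y) yn.
Qed.

Lemma T_map_intertwiner :
  intertwiner (@act_T R k dd F D) (calT R dd D) (@act_M R F D) (calM R D)
    (@T_map R k dd n F D).
Proof.
split.
- by move=> g f /strata_spanP stf; apply/strata_spanP/act_T_stratified.
- by move=> g f /calMP stf; apply/calMP/act_M_stratified.
- exact: T_map_linear.
- by move=> f _; apply/calMP/T_map_stratified.
by move=> g f _; exact: T_map_act.
Qed.

End Intertwining.

(** * The module of functions of rank [r] *)

Section RankModule.
Variables (R : realType) (F : finFieldType) (D : vectType F) (mu r : nat).
Hypothesis dimD : \dim {:D} = (mu + 2 * r)%N.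
Implicit Types (x : M_points D) (v : Vmu (Cq R) mu).

(** The basis vector [v_i] goes to the indicator of the stratum of rank [r] with [dim W = r + i]. In
    rank [r], [dim W] runs from [r] to [mu + r], so [inord] stays in range. *)
Definition of_Vmu v : functions R M_family D :=
  [ffun x => (\dim (limg (endt x)) == r)%:R * v 0 (inord (\dim (spW x) - r))].

Lemma of_Vmu_rank v x : \dim (limg (endt x)) = r ->
  of_Vmu v x = v 0 (inord (\dim (spW x) - r)).
Proof. by move=> xr; rewrite ffunE xr eqxx mul1r. Qed.

Lemma of_Vmu_eq0 v x : \dim (limg (endt x)) != r -> of_Vmu v x = 0.
Proof. by move=> /negPf xr; rewrite ffunE xr mul0r. Qed.

Lemma value_on_of_Vmu v w : (r <= w)%N -> (w <= mu + r)%N ->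
  value_on (of_Vmu v) (w, r) = v 0 (inord (w - r)).
Proof.
move=> le_rw le_w; have [x xwr] : exists x : M_points D, M_label x = (w, r).
  by apply: M_exists; rewrite ?dimD; lia.
have [xw xr] := xwr; rewrite /value_on; case: pickP => [y|/(_ x)]; last first.
  by rewrite /= xwr eqxx.
by move=> /eqP[yw yr]; rewrite of_Vmu_rank // yw.
Qed.

Lemma value_on_of_Vmu_eq0 v w s : s != r -> value_on (of_Vmu v) (w, s) = 0.
Proof.
by move=> sr; rewrite /value_on; case: pickP => // y /eqP[_ ys]; rewrite of_Vmu_eq0 // ys.
Qed.

Lemma of_Vmu_linear : linear of_Vmu.
Proof.
move=> a u v; apply/ffunP => x; rewrite !ffunE !mxE mulrDr; congr (_ + _).
exact: mulrCA.
Qed.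

Lemma of_Vmu_stratified v : stratified (of_Vmu v).
Proof. by move=> x y [xy1 xy2]; rewrite !ffunE xy1 xy2. Qed.

(** Put [j = dim W - r]. By [qint_at_q2], the coefficient of [E] is the quantum integer of
    [dim ker t - dim W = mu - j] and that of [F] the one of [j], as in [Vmu_E] and [Vmu_F]. *)
Lemma of_Vmu_act g v : of_Vmu (Vmu_act q g v) = act_M g (of_Vmu v).
Proof.
have qV0 := q_neq0 R.
apply/ffunP => x; have [le_rw le_wrd] := M_label_bounds x; rewrite /= in le_rw le_wrd.
have [xr|xr] := eqVneq (\dim (limg (endt x))) r; last first.
  rewrite of_Vmu_eq0 // ffunE gsum_M_up gsum_M_down !value_on_of_Vmu_eq0 //.
  by rewrite of_Vmu_eq0 // !mul0r; case: g => /=; rewrite ?mulr0.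
rewrite of_Vmu_rank // ffunE gsum_M_up gsum_M_down of_Vmu_rank // dim_lker xr dimD.
rewrite xr dimD in le_rw le_wrd.
set w := \dim (spW x) in le_rw le_wrd *.
have jE : ((inord (w - r) : 'I_mu.+1) : nat) = (w - r)%N by rewrite inordK //; lia.
case: g => /=.
- rewrite Vmu_E // jE.
  have -> : - ((mu + 2 * r - r)%N%:Z - w%:Z - 1) = - ((mu + 2 * r - r - w)%N%:Z - 1) by lia.
  rewrite mulrCA qint_at_q2 (_ : mu + 2 * r - r - w = mu - (w - r))%N; last lia.
  (* When [W] fills the kernel the next index is out of range, and the coefficient [qint 0] removes
     the term. *)
  have [ltw|gew] := ltnP w (mu + r); last first.
    by rewrite (_ : mu - (w - r) = 0)%N ?qint0 ?mul0r ?mulr0 //; lia.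
  rewrite value_on_of_Vmu; [|lia|lia]; rewrite mulrC -subSn //.
- rewrite Vmu_F // jE.
  have -> : - (w%:Z - r%:Z - 1) = - ((w - r)%N%:Z - 1) by lia.
  rewrite mulrCA qint_at_q2.
  have [w0|ltw] := posnP (w - r)%N; first by rewrite w0 qint0 mul0r mulr0.
  rewrite value_on_of_Vmu; [|lia|lia]; rewrite mulrC.
  by congr (v 0 (inord _) * _); lia.
- rewrite Vmu_K jE; congr (q ^ _ * _); lia.
rewrite Vmu_Kinv jE invr_expz; congr (q ^ _ * _); lia.
Qed.

Lemma of_Vmu_iso : Uq_isomorphic (@Vmu_act (Cq R) q mu) (@act_M R F D) (calMr R D r).
Proof.
have of_calMr v : of_Vmu v \in calMr R D r.
  by apply/calMrP; split=> [|x]; [exact: of_Vmu_stratified | exact: of_Vmu_eq0].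
have onto f : f \in calMr R D r -> exists v, of_Vmu v = f.
  move=> /calMrP[stf f0]; exists (\row_j value_on f (r + j, r)%N).
  apply/ffunP => x; have [le_rw le_wrd] := M_label_bounds x; rewrite /= in le_rw le_wrd.
  have [xr|xr] := eqVneq (\dim (limg (endt x))) r; last by rewrite of_Vmu_eq0 // f0.
  rewrite of_Vmu_rank // mxE inordK; last by rewrite xr dimD in le_rw le_wrd; lia.
  rewrite xr in le_rw; rewrite subnKC // -(value_onE x stf).
  by rewrite -[label _]/(M_label x) /M_label xr.
exists of_Vmu; split=> //.
  split=> [g v _|g f /onto[v <-]||v _|g v _].
  - exact: memvf.
  - by rewrite -of_Vmu_act.
  - exact: of_Vmu_linear.
  - exact: of_calMr.
  - exact: of_Vmu_act.
(* All the strata of rank [r] involved are non-empty, so each coordinate can be read back from the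
   function. *)
move=> u v uv; apply/rowP => j.
have ltj := ltn_ord j.
have := congr1 (fun f : functions R M_family D => value_on f (r + j, r)%N) uv.
by rewrite !value_on_of_Vmu ?addKn ?inord_val //; lia.
Qed.

End RankModule.

(** * Crossingless matches *)

Section MatchCount.
Variables (k : nat) (dd : {ffun 'I_k -> nat}) (b : {set vertex dd * vertex dd}).
Hypothesis lcb : lower_crossingless b.

Lemma arc_endpoint_inj a a' (v : vertex dd) :
  a \in b -> a' \in b -> endpoint v a -> endpoint v a' -> a = a'.
Proof. by case: lcb => _ inj_b _ _; exact: inj_b. Qed.

Lemma card_vertex : #|{: vertex dd}| = (\sum_(i < k) dd i)%N.
Proof.
rewrite card_tagged sumnE big_map big_enum /=.
by apply: eq_bigr => i _; rewrite card_ord.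
Qed.

(** Arcs inject into their left and into their right endpoints, and these two sets are disjoint: a
    common vertex would make both ends of one arc lie in the same box. *)
Lemma card_unmatched : (#|unmatched b| + 2 * #|b| = \sum_(i < k) dd i)%N.
Proof.
have fst_inj : {in b &, injective fst}.
  by move=> a a' ab ab' eq_a; apply: (@arc_endpoint_inj _ _ a.1); rewrite // /endpoint ?eq_a eqxx.
have snd_inj : {in b &, injective snd}.
  by move=> a a' ab ab' eq_a; apply: (@arc_endpoint_inj _ _ a.2);
    rewrite // /endpoint ?eq_a eqxx ?orbT.
have -> : unmatched b = ~: ((fst @: b) :|: (snd @: b)).
  apply/setP => v; rewrite !inE negb_or; apply/forall_inP/andP.
    by move=> vb; split; apply/imsetP => -[a /vb + va]; rewrite /endpoint va eqxx ?orbT.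
  move=> [v1 v2] a ab; rewrite /endpoint negb_or; apply/andP; split.
    by apply: contraNneq v1 => ->; exact: imset_f.
  by apply: contraNneq v2 => ->; exact: imset_f.
rewrite -card_vertex -[RHS](cardsC ((fst @: b) :|: (snd @: b))) addnC; congr (_ + _)%N.
rewrite cardsU !card_in_imset // (_ : _ :&: _ = finset.set0).
  by rewrite cards0 subn0 addnn -mul2n.
apply/setP => v; rewrite !inE; apply/andP => -[/imsetP[a ab va] /imsetP[a' ab' va']].
have aa' : a = a'.
  by apply: (@arc_endpoint_inj _ _ v); rewrite // /endpoint -?va -?va' eqxx ?orbT.
case: lcb => /(_ a ab)[_]; rewrite -va aa' va' eqxx //.
Qed.

(** Distinct arcs have distinct right endpoints, so no box has more than [dd i] of them and the
    truncated subtractions in [nvec] are exact and add up. *)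
Lemma psum_nvec : psum (nvec b) k = (\sum_(i < k) dd i - #|b|)%N.
Proof.
have le_right i : (#|[set a in b | tag a.2 == i]| <= dd i)%N.
  rewrite -(card_in_imset (f := snd)); last first.
    move=> a a'; rewrite !inE => /andP[ab _] /andP[ab' _] eq_a.
    by apply: (@arc_endpoint_inj _ _ a.2); rewrite // /endpoint ?eq_a eqxx ?orbT.
  rewrite -[X in (_ <= X)%N]card_ord -cardsT.
  apply: leq_trans (leq_imset_card (fun j : 'I_(dd i) => Tagged (fun l => 'I_(dd l)) j) _).
  apply/subset_leq_card/fintype.subsetP => v /imsetP[a]; rewrite inE => /andP[_ /eqP ai] ->.
  by case: a.2 ai => l j /= <-; apply/imsetP; exists j.
have sum_right : (\sum_(i < k) #|[set a in b | tag a.2 == i]| = #|b|)%N.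
  rewrite -sum1_card (partition_big (fun a : vertex dd * vertex dd => tag a.2) predT) //=.
  by apply: eq_bigr => i _; rewrite -sum1_card; apply: eq_bigl => a; rewrite inE.
rewrite psum_full -sum_right -sumnB => [|i _]; last exact: le_right.
by apply: eq_bigr => i _; rewrite ffunE.
Qed.

End MatchCount.

Theorem proposition3p2p2 (R : realType) (F : finFieldType) (D : vectType F)
    (k : nat) (dd : {ffun 'I_k -> nat}) (b : {set vertex dd * vertex dd}) :
  (0 < k)%N ->
  \dim {:D} = (\sum_(i < k) dd i)%N ->
  lower_crossingless b ->
  intertwiner (@act_T R k dd F D) (calT R dd D) (@act_M R F D) (calM R D)
              (@T_map R k dd (nvec b) F D) /\
  (forall mu r : nat,
     mu = #|unmatched b| ->
     r = (\dim {:D} - mu)./2 ->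
     (forall f, f \in calT R dd D -> @T_map R k dd (nvec b) F D f \in calMr R D r) /\
     Uq_isomorphic (@Vmu_act (Cq R) q mu) (@act_M R F D) (calMr R D r)).
Proof.
move=> _ dimD lcb; split; first exact: T_map_intertwiner.
move=> mu r muE rE.
have unmatchedE := card_unmatched lcb; rewrite -dimD -muE in unmatchedE.
(* Halving is exact: [d - mu] is twice the number of arcs. *)
have rb : r = #|b| by lia.
split=> [f _|]; last by apply: of_Vmu_iso; lia.
apply/calMrP; split=> [|x xr]; first exact: T_map_stratified.
apply: T_map_eq0 => //; rewrite psum_nvec // dim_lker -dimD -rb.
have := dimvS (subvf (limg (endt x))); lia.
Qed.
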